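(* If $G$ is a nonabelian, torsion-free, locally nilpotent group, then the action of $\mathrm{Comm}(G)$ on $\mathrm{LO}(G)$ is faithful.
   Context: A left-invariant order on a group $G$ is a (strict) total order $\prec$ on $G$ such that $x \prec y \Rightarrow gx \prec gy$ for all $x,y,g \in G$; $\mathrm{LO}(G)$ is the set of all of them. An isomorphism $\phi\colon G_1 \to G_2$ induces a bijection $\mathrm{LO}(G_1)\to\mathrm{LO}(G_2)$, sending $\prec$ to the order $\prec^\phi$ defined by $\phi(x) \prec^\phi \phi(y) \iff x \prec y$. A commensuration of $G$ is an isomorphism $\phi \colon G_1 \to G_2$, where $G_1$ and $G_2$ are finite-index subgroups of $G$. Two commensurations $\phi \colon G_1 \to G_2$ and $\phi' \colon G_1' \to G_2'$ are equivalent if there is a finite-index subgroup $H$ of $G_1 \cap G_1'$ such that $\phi$ and $\phi'$ have the same restriction to $H$. The equivalence classes of commensurations form a group $\mathrm{Comm}(G)$ (the abstract commensurator), with multiplication given by composition restricted to a finite-index subgroup where it is defined. When $G$ is torsion-free and locally nilpotent, for every finite-index subgroup $H$ of $G$ the restriction map $\mathrm{LO}(G)\to\mathrm{LO}(H)$ is a bijection, and $\mathrm{Comm}(G)$ acts on $\mathrm{LO}(G)$ as follows: the class of $\phi\colon G_1 \to G_2$ acts by the composition $\mathrm{LO}(G) \to \mathrm{LO}(G_1) \to \mathrm{LO}(G_2) \to \mathrm{LO}(G)$ of restriction, the bijection induced by $\phi$, and the inverse of restriction. (Elements of $\mathrm{Comm}(G)$ are written as acting on the right.) A group is locally nilpotent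 if each of its finitely generated subgroups is nilpotent. *)

(* Defs.v *)
From HB Require Import structures.
From mathcomp Require Import all_boot.
From mathcomp Require Import boolp classical_sets cardinality.

Set Implicit Arguments.
Unset Strict Implicit.
Unset Printing Implicit Defensive.

Local Open Scope classical_set_scope.
Local Open Scope group_scope.
Local Open Scope quotient_scope.

(* Groups are possibly infinite ([groupType]); a subgroup of [G] is a        *)
(* [groupClosed G], which [subg_of] turns into a group in its own right.     *)

Section SubgroupType.
Variables (G : groupType) (H : groupClosed G).

Record subg_of := Subg { subg_val : G; subg_valP : subg_val \in H }.

HB.instance Definition _ := [isSub for subg_val].
HB.instance Definition _ := [Choice of subg_of by <:].

Lemma subg_of_closed : group_closed (fun x => x \in H).
Proof. by split=> [|x y]; [exact: gpred1 | exact: gpredF]. Qed.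

HB.instance Definition _ :=
  SubChoice_isSubGroup.Build G _ subg_of subg_of_closed.

End SubgroupType.

Section Subgroups.
Variable G : groupType.
Implicit Types H K : groupClosed G.

Definition fullg : {pred G} := predT.

Lemma fullgM : mulg_closed fullg. Proof. by []. Qed.
Lemma fullg1 : 1 \in fullg. Proof. by []. Qed.
Lemma fullgV : invg_closed fullg. Proof. by []. Qed.
HB.instance Definition _ := isMulClosed.Build G fullg fullgM.
HB.instance Definition _ := isMul1Closed.Build G fullg fullg1.
HB.instance Definition _ := isInvClosed.Build G fullg fullgV.

Definition capg H K : {pred G} := [pred x | (x \in H) && (x \in K)].

Lemma in_capg H K x : (x \in capg H K) = (x \in H) && (x \in K).
Proof. by []. Qed.

Section Cap.
Variables H K : groupClosed G.
Lemma capgM : mulg_closed (capg H K).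
Proof.
by move=> x y; rewrite !in_capg => /andP[? ?] /andP[? ?]; rewrite !gpredM.
Qed.
Lemma capg1 : 1 \in capg H K. Proof. by rewrite in_capg !gpred1. Qed.
Lemma capgV : invg_closed (capg H K).
Proof. by move=> x; rewrite !in_capg !gpredV. Qed.
HB.instance Definition _ := isMulClosed.Build G (capg H K) capgM.
HB.instance Definition _ := isMul1Closed.Build G (capg H K) capg1.
HB.instance Definition _ := isInvClosed.Build G (capg H K) capgV.
End Cap.

Definition gen (A : set G) : set G :=
  [set x | forall H, (forall a, A a -> a \in H) -> x \in H].

Definition finitely_generated H :=
  exists s : seq G, [set` H] = gen [set` s].

Definition left_coset H (x : G) : set G := [set x * h | h in [set` H]].

Definition finite_index K H :=
  {subset H <= K} /\ finite_set [set left_coset H x | x in [set` K]].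

Fixpoint lower_central (n : nat) : set G :=
  if n is m.+1 then gen [set [~ x, y] | x in lower_central m & y in setT]
  else setT.

Definition nilpotent_group := exists n, lower_central n = [set 1].

Definition torsion_free :=
  forall (x : G) (n : nat), (0 < n)%N -> x ^+ n = 1 -> x = 1.

Definition abelian_group := forall x y : G, x * y = y * x.

End Subgroups.

Arguments fullg G : clear implicits.

Definition locally_nilpotent (G : groupType) :=
  forall H : groupClosed G,
    finitely_generated H -> nilpotent_group (subg_of H).

Section LeftOrders.

Record left_order (G : groupType) := LeftOrder {
  lo_lt :> rel G;
  lo_irr : irreflexive lo_lt;
  lo_trans : transitive lo_lt;
  lo_total : forall x y, x != y -> lo_lt x y || lo_lt y x;
  lo_inv : forall g x y, lo_lt x y -> lo_lt (g * x) (g * y)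
}.

Lemma left_order_ext (G : groupType) (o o' : left_order G) :
  (forall x y, o x y = o' x y) -> o = o'.
Proof.
case: o o' => [r a b c d] [r' a' b' c' d'] /= e.
have {}e : r = r' by apply/funext => x; apply/funext => y.
by subst r'; f_equal; apply: Prop_irrelevance.
Qed.

HB.instance Definition _ (G : groupType) := gen_eqMixin (left_order G).
HB.instance Definition _ (G : groupType) := gen_choiceMixin (left_order G).

Record group_iso (K L : groupType) := GroupIso {
  iso_fun :> K -> L;
  iso_inv : L -> K;
  isoM : {morph iso_fun : x y / x * y};
  isoK : cancel iso_fun iso_inv;
  iso_invK : cancel iso_inv iso_fun
}.

Section Image.
Variables (K L : groupType) (f : group_iso K L) (o : left_order K).

Lemma iso_invM : {morph iso_inv f : x y / x * y}.
Proof.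
by move=> x y; apply: (can_inj (isoK f)); rewrite isoM !iso_invK.
Qed.

Let r : rel L := fun x y => o (iso_inv f x) (iso_inv f y).
Let r_irr : irreflexive r. Proof. by move=> x; exact: lo_irr. Qed.
Let r_trans : transitive r. Proof. by move=> y x z; exact: lo_trans. Qed.
Let r_total x y : x != y -> r x y || r y x.
Proof. by move=> xy; apply: lo_total; rewrite (can_eq (iso_invK f)). Qed.
Let r_inv g x y : r x y -> r (g * x) (g * y).
Proof. by rewrite /r !iso_invM; exact: lo_inv. Qed.

Definition lo_image : left_order L := LeftOrder r_irr r_trans r_total r_inv.

Lemma lo_imageE x y : lo_image (f x) (f y) = o x y.
Proof. by rewrite /= /r !isoK. Qed.
End Image.

Section Restriction.
Variables (G : groupType) (H : groupClosed G).

Section Restr.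
Variable o : left_order G.
Let r : rel (subg_of H) := fun x y => o (val x) (val y).
Let r_irr : irreflexive r. Proof. by move=> x; exact: lo_irr. Qed.
Let r_trans : transitive r. Proof. by move=> y x z; exact: lo_trans. Qed.
Let r_total x y : x != y -> r x y || r y x.
Proof. by move=> xy; apply: lo_total; rewrite (inj_eq val_inj). Qed.
Let r_inv g x y : r x y -> r (g * x) (g * y).
Proof. exact: lo_inv. Qed.

Definition lo_restr : left_order (subg_of H) :=
  LeftOrder r_irr r_trans r_total r_inv.
End Restr.

(* The inverse of [lo_restr], as a total function: [o0] is only returned at *)
(* points outside the range of [lo_restr], of which there are none when [G] *)
(* is torsion-free locally nilpotent and [H] has finite index.              *)
Definition lo_extend (o0 : left_order G) (q : left_order (subg_of H)) :
  left_order G := xget o0 [set o | lo_restr o = q].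

End Restriction.

End LeftOrders.

Record commensuration (G : groupType) := Commensuration {
  dom : groupClosed G;
  cod : groupClosed G;
  dom_index : finite_index (fullg G) dom;
  cod_index : finite_index (fullg G) cod;
  comm_iso :> group_iso (subg_of dom) (subg_of cod)
}.

HB.instance Definition _ (G : groupType) := gen_eqMixin (commensuration G).
HB.instance Definition _ (G : groupType) := gen_choiceMixin (commensuration G).

Definition comm_equiv (G : groupType) (f f' : commensuration G) :=
  exists H : groupClosed G, finite_index (capg (dom f) (dom f')) H /\
    forall (x : subg_of (dom f)) (x' : subg_of (dom f')),
      val x \in H -> val x = val x' -> val (f x) = val (f' x').

Section FiniteIndex.
Variable G : groupType.
Implicit Types H K : groupClosed G.

Lemma left_cosetP H x y : left_coset H x = left_coset H y <-> x^-1 * y \in H.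
Proof.
split=> [e|xyH].
  have : left_coset H y y by exists 1; rewrite ?mulg1 //= gpred1.
  by rewrite -e => -[h hH <-]; rewrite mulKg.
apply/seteqP; split=> _ [h hH <-].
  exists ((x^-1 * y)^-1 * h); first by rewrite /= gpredM// gpredV.
  by rewrite invgM invgK !mulgA mulgV mul1g.
exists (x^-1 * y * h); first by rewrite /= gpredM.
by rewrite !mulgA mulgV mul1g.
Qed.

Lemma finite_cosets K H (U : Type) (h : G -> U) :
    finite_set [set h x | x in [set` K]] ->
    (forall x y, x \in K -> y \in K -> h x = h y -> x^-1 * y \in H) ->
  finite_set [set left_coset H x | x in [set` K]].
Proof.
move=> fh hP; pose t u := xget 1 [set x | x \in K /\ h x = u].
apply: sub_finite_set (finite_image (fun u => left_coset H (t u)) fh).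
move=> _ [x xK <-]; exists (h x); first by exists x.
have [tK th] : t (h x) \in K /\ h (t (h x)) = h x.
  exact: (@xgetI _ 1 [set y | y \in K /\ h y = h x] x).
exact/left_cosetP/hP.
Qed.

Lemma finite_cosets_trans K (A : groupClosed G) H (U : Type) (h : G -> U) :
    finite_index K A -> finite_set [set h x | x in [set` A]] ->
    (forall x y, x \in A -> y \in A -> h x = h y -> x^-1 * y \in H) ->
  finite_set [set left_coset H x | x in [set` K]].
Proof.
move=> [sAK fA] fh hP; pose t u := xget 1 [set x | x \in K /\ left_coset A x = u].
have tP x : x \in K -> (t (left_coset A x))^-1 * x \in A.
  move=> xK; apply/left_cosetP.
  have [] // : t (left_coset A x) \in K /\
      left_coset A (t (left_coset A x)) = left_coset A x.
  exact: (@xgetI _ 1 [set y | y \in K /\ left_coset A y = left_coset A x] x).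
pose g x := (left_coset A x, h ((t (left_coset A x))^-1 * x)).
apply: (@finite_cosets K H _ g).
  apply: sub_finite_set (finite_setX fA fh) => _ [x xK <-].
  by split=> /=; [exists x | exists ((t (left_coset A x))^-1 * x); first exact: tP].
move=> x y xK yK [exy eh]; have tx := tP x xK; have ty := tP y yK.
by have := hP _ _ tx ty eh; rewrite exy invgM invgK mulgA mulgK.
Qed.

Lemma finite_index_trans K A H :
  finite_index K A -> finite_index A H -> finite_index K H.
Proof.
move=> KA [sHA fH]; split; first by move=> x /sHA; exact: KA.1.
by apply: finite_cosets_trans KA fH _ => x y _ _ /left_cosetP.
Qed.

Lemma finite_index_sub (K A H : groupClosed G) :
  finite_index K H -> {subset H <= A} -> {subset A <= K} -> finite_index A H.
Proof.
move=> [_ fH] sHA sAK; split=> //; apply: sub_finite_set fH.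
by move=> _ [x /sAK xK <-]; exists x.
Qed.

Lemma finite_index_cap K A B :
  finite_index K A -> finite_index K B -> finite_index K (capg A B).
Proof.
move=> [sA fA] [sB fB]; split.
  by move=> x; rewrite in_capg => /andP[/sA].
apply: (@finite_cosets _ _ _ (fun x => (left_coset A x, left_coset B x))).
  by apply: sub_finite_set (finite_setX fA fB) => _ [x xK <-]; split; exists x.
move=> x y _ _ [/left_cosetP xA /left_cosetP xB].
by rewrite in_capg xA.
Qed.

Lemma finite_index_full : finite_index (fullg G) (fullg G).
Proof.
by split=> //; apply: (@finite_cosets _ _ _ (fun=> tt)).
Qed.

End FiniteIndex.

(* [maps f x y] is the graph of a commensuration, as a relation on [G]. *)
Section Graph.
Variable G : groupType.
Implicit Types (f g h : commensuration G) (x y z : G) (H L : groupClosed G).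

Definition maps f x y :=
  exists a : subg_of (dom f), val a = x /\ val (f a) = y.

Lemma maps_fun f x y y' : maps f x y -> maps f x y' -> y = y'.
Proof. by move=> [a [<- <-]] [b [/val_inj-> <-]]. Qed.

Lemma mapsM f x x' y y' : maps f x y -> maps f x' y' -> maps f (x * x') (y * y').
Proof.
move=> [a [<- <-]] [b [<- <-]]; exists (a * b).
by rewrite isoM !valM.
Qed.

Lemma maps1 f : maps f 1 1.
Proof.
exists 1; split; first exact: val1.
have : f 1 * f 1 = f 1 * 1 by rewrite -isoM !mulg1.
by move/mulgI ->; exact: val1.
Qed.

Lemma maps_dom f x : x \in dom f <-> exists y, maps f x y.
Proof.
split=> [xf|[_ [a [<- _]]]]; last exact: subg_valP.
by exists (val (f (Subg xf))), (Subg xf).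
Qed.

Lemma mapsV f x y : maps f x y -> maps f x^-1 y^-1.
Proof.
move=> fxy; have [z fz] : exists z, maps f x^-1 z.
  by apply/maps_dom; rewrite gpredV; apply/maps_dom; exists y.
have := mapsM fxy fz; rewrite mulgV => /maps_fun/(_ (maps1 f)) yz.
by rewrite -(mulKg y z) yz mulg1 in fz.
Qed.

Lemma comm_equivP f f' : comm_equiv f f' <->
  exists H, finite_index (fullg G) H /\
    forall x, x \in H -> exists y, maps f x y /\ maps f' x y.
Proof.
split=> [[H [iH HP]]|[H [iH HP]]].
  exists H; split.
    by apply: finite_index_trans iH; apply: finite_index_cap; exact: dom_index.
  move=> x xH; have /andP[xf xf'] : x \in capg (dom f) (dom f') by exact: iH.1.
  exists (val (f (Subg xf))); split; first by exists (Subg xf).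
  by exists (Subg xf'); split=> //; rewrite -(HP (Subg xf) (Subg xf')).
have sH : {subset H <= capg (dom f) (dom f')}.
  move=> x /HP[y [fx fx']]; rewrite in_capg.
  by apply/andP; split; apply/maps_dom; exists y.
exists H; split; first exact: finite_index_sub iH sH _.
move=> x x' /HP[y [fx fx']] e.
have -> : val (f x) = y by apply: maps_fun fx; exists x.
by symmetry; apply: maps_fun fx'; exists x'.
Qed.

Section Preimage.
Variables (f : commensuration G) (L : groupClosed G).

Definition preg : {pred G} := fun x => `[< exists y, maps f x y /\ y \in L >].

Lemma pregP x : reflect (exists y, maps f x y /\ y \in L) (x \in preg).
Proof. exact: asboolP. Qed.

Lemma pregM : mulg_closed preg.
Proof.
move=> x x' /pregP[y [xy yL]] /pregP[y' [xy' yL']]; apply/pregP.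
by exists (y * y'); rewrite gpredM//; split=> //; exact: mapsM.
Qed.
Lemma preg1 : 1 \in preg.
Proof. by apply/pregP; exists 1; rewrite gpred1; split=> //; exact: maps1. Qed.
Lemma pregV : invg_closed preg.
Proof.
move=> x /pregP[y [xy yL]]; apply/pregP.
by exists y^-1; rewrite gpredV; split=> //; exact: mapsV.
Qed.
HB.instance Definition _ := isMulClosed.Build G preg pregM.
HB.instance Definition _ := isMul1Closed.Build G preg preg1.
HB.instance Definition _ := isInvClosed.Build G preg pregV.
End Preimage.

Lemma preg_index f L :
  finite_index (fullg G) L -> finite_index (fullg G) (preg f L).
Proof.
move=> [_ fL]; split=> //.
pose app x := xget 1 [set y | maps f x y].
have appP x : x \in dom f -> maps f x (app x).
  by move=> /maps_dom[y fy]; exact: (@xgetI _ 1 [set y | maps f x y] y).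
apply: (finite_cosets_trans (h := fun x => left_coset L (app x)) (dom_index f)).
  by apply: sub_finite_set fL => _ [x _ <-]; exists (app x).
move=> x y /appP fx /appP fy /left_cosetP xyL; apply/pregP.
by exists ((app x)^-1 * app y); split=> //; apply: mapsM fy; exact: mapsV.
Qed.

End Graph.

Section Operations.
Variable G : groupType.
Implicit Types f g h : commensuration G.

Section FullIso.
Let i : subg_of (fullg G) -> subg_of (fullg G) := id.
Let iM : {morph i : x y / x * y}. Proof. by []. Qed.
Let iK : cancel i i. Proof. by []. Qed.

Definition comm_id : commensuration G :=
  Commensuration (finite_index_full G) (finite_index_full G)
    (GroupIso iM iK iK).
End FullIso.

Definition comm_inv f : commensuration G :=
  Commensuration (cod_index f) (dom_index f)
    (GroupIso (iso_invM (comm_iso f)) (iso_invK (comm_iso f))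
       (isoK (comm_iso f))).

Lemma maps_id x : maps comm_id x x.
Proof. by have xG : x \in fullg G by []; exists (Subg xG). Qed.

Lemma maps_inv f x y : maps (comm_inv f) y x <-> maps f x y.
Proof.
split=> [[a [<- <-]]|[a [<- <-]]].
  by exists (iso_inv f a); rewrite iso_invK.
by exists (f a); split=> //=; rewrite isoK.
Qed.

(* [comm_comp f g] is "first f, then g". *)
Section Composition.
Variables f g : commensuration G.

Let D := preg f (dom g).
Let C := preg (comm_inv g) (cod f).

Lemma comp_funP (x : subg_of D) : exists y : subg_of C,
  exists2 z, maps f (val x) z & maps g z (val y).
Proof.
case: x => x /= /pregP[z [fz zg]]; have /maps_dom[y gz] := zg.
have yC : y \in C.
  apply/pregP; exists z; split; first exact/maps_inv.
  by case: fz => a [_ <-]; exact: subg_valP.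
by exists (Subg yC), z.
Qed.

Lemma comp_invP (y : subg_of C) : exists x : subg_of D,
  exists2 z, maps f (val x) z & maps g z (val y).
Proof.
case: y => y /= /pregP[z [/maps_inv gz zf]].
have /(maps_dom (comm_inv f))[x /maps_inv fx] := zf.
have xD : x \in D by apply/pregP; exists z; split=> //; apply/maps_dom; exists y.
by exists (Subg xD), z.
Qed.

Let u x := projT1 (cid (comp_funP x)).
Let v y := projT1 (cid (comp_invP y)).

Let uP x : exists2 z, maps f (val x) z & maps g z (val (u x)).
Proof. exact: projT2 (cid (comp_funP x)). Qed.
Let vP y : exists2 z, maps f (val (v y)) z & maps g z (val y).
Proof. exact: projT2 (cid (comp_invP y)). Qed.

Let uM : {morph u : x y / x * y}.
Proof.
move=> x y; apply: val_inj; rewrite valM.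
have [a fa ga] := uP x; have [b fb gb] := uP y; have [c] := uP (x * y).
rewrite valM => fc gc; have := mapsM fa fb => /maps_fun/(_ fc) e.
by have := mapsM ga gb; rewrite e => /maps_fun/(_ gc).
Qed.

Let uK : cancel u v.
Proof.
move=> x; apply: val_inj; have [a fa ga] := uP x; have [b fb gb] := vP (u x).
move/maps_inv: ga => ga; move/maps_inv: gb => /(maps_fun ga) e.
rewrite -{}e in fb.
by move/maps_inv: fa => fa; move/maps_inv: fb => /(maps_fun fa).
Qed.

Let vK : cancel v u.
Proof.
move=> y; apply: val_inj; have [a fa ga] := vP y; have [b fb gb] := uP (v y).
by move: gb; rewrite -(maps_fun fa fb) => /(maps_fun ga).
Qed.

Definition comm_comp : commensuration G :=
  Commensuration (preg_index f (dom_index g))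
    (preg_index (comm_inv g) (cod_index f)) (GroupIso uM uK vK).

Lemma maps_comp x y :
  maps comm_comp x y <-> exists z, maps f x z /\ maps g z y.
Proof.
split=> [[a [<- <-]]|[z [fz gz]]]; first by have [z ? ?] := uP a; exists z.
have xD : x \in D by apply/pregP; exists z; split=> //; apply/maps_dom; exists y.
exists (Subg xD); split=> //=; have [a fa ga] := uP (Subg xD).
by move: ga; rewrite -(maps_fun fz fa) => /(maps_fun gz).
Qed.

End Composition.

Lemma comm_equiv_refl f : comm_equiv f f.
Proof.
apply/comm_equivP; exists (dom f); split; first exact: dom_index.
by move=> x /maps_dom[y fy]; exists y.
Qed.

Lemma comm_equiv_sym f g : comm_equiv f g -> comm_equiv g f.
Proof.
move=> /comm_equivP[H [iH HP]]; apply/comm_equivP; exists H; split=> //.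
by move=> x /HP[y [? ?]]; exists y.
Qed.

Lemma comm_equiv_trans g f h :
  comm_equiv f g -> comm_equiv g h -> comm_equiv f h.
Proof.
move=> /comm_equivP[H [iH HP]] /comm_equivP[L [iL LP]]; apply/comm_equivP.
pose M : groupClosed G := capg H L.
exists M; split; first exact: finite_index_cap.
move=> x; rewrite in_capg => /andP[/HP[y [fy gy]] /LP[z [gz hz]]].
by exists y; split=> //; rewrite (maps_fun gy gz).
Qed.

Lemma comm_comp_equiv f f' g g' : comm_equiv f f' -> comm_equiv g g' ->
  comm_equiv (comm_comp f g) (comm_comp f' g').
Proof.
move=> /comm_equivP[H [iH HP]] /comm_equivP[L [iL LP]]; apply/comm_equivP.
pose M : groupClosed G := capg H (preg f L).
exists M; split.
  by apply: finite_index_cap => //; exact: preg_index.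
move=> x; rewrite in_capg => /andP[/HP[y [fy fy']] /pregP[z [fz /LP[t [gt gt']]]]].
rewrite -(maps_fun fy fz) in gt gt'.
by exists t; split; apply/maps_comp; exists y.
Qed.

Lemma comm_inv_equiv f f' :
  comm_equiv f f' -> comm_equiv (comm_inv f) (comm_inv f').
Proof.
move=> /comm_equivP[H [iH HP]]; apply/comm_equivP.
pose M : groupClosed G := preg (comm_inv f) H.
exists M; split; first exact: preg_index.
move=> y /pregP[x [fy /HP[z [fz fz']]]]; exists x; split=> //.
by apply/maps_inv; move/maps_inv: fy => /(maps_fun fz) <-.
Qed.

Lemma comm_compA f g h :
  comm_equiv (comm_comp f (comm_comp g h)) (comm_comp (comm_comp f g) h).
Proof.
apply/comm_equivP; exists (dom (comm_comp f (comm_comp g h))).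
split; first exact: dom_index.
move=> x /maps_dom[y fy]; exists y; split=> //.
move: fy => /maps_comp[a [fa /maps_comp[b [gb hb]]]].
by apply/maps_comp; exists b; split=> //; apply/maps_comp; exists a.
Qed.

Lemma comm_comp_id f : comm_equiv (comm_comp comm_id f) f.
Proof.
apply/comm_equivP; exists (dom f); split; first exact: dom_index.
move=> x /maps_dom[y fy]; exists y; split=> //.
by apply/maps_comp; exists x; split=> //; exact: maps_id.
Qed.

Lemma comm_compid f : comm_equiv (comm_comp f comm_id) f.
Proof.
apply/comm_equivP; exists (dom f); split; first exact: dom_index.
move=> x /maps_dom[y fy]; exists y; split=> //.
by apply/maps_comp; exists y; split=> //; exact: maps_id.
Qed.

Lemma comm_compV f : comm_equiv (comm_comp f (comm_inv f)) comm_id.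
Proof.
apply/comm_equivP; exists (dom f); split; first exact: dom_index.
move=> x /maps_dom[y fy]; exists x; split; last exact: maps_id.
by apply/maps_comp; exists y; split=> //; exact/maps_inv.
Qed.

Lemma comm_comp_inv f : comm_equiv (comm_comp (comm_inv f) f) comm_id.
Proof.
apply/comm_equivP; exists (cod f); split; first exact: cod_index.
move=> x /(maps_dom (comm_inv f))[y /maps_inv fy]; exists x.
split; last exact: maps_id.
by apply/maps_comp; exists y; split=> //; exact/maps_inv.
Qed.

Definition comm_rel : rel (commensuration G) :=
  fun f g => `[< comm_equiv f g >].

Lemma comm_rel_refl : reflexive comm_rel.
Proof. by move=> f; apply/asboolP; exact: comm_equiv_refl. Qed.
Lemma comm_rel_sym : symmetric comm_rel.
Proof. by move=> f g; apply/asboolP/asboolP; exact: comm_equiv_sym. Qed.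
Lemma comm_rel_trans : transitive comm_rel.
Proof.
move=> g f h /asboolP fg /asboolP gh; apply/asboolP.
exact: comm_equiv_trans fg gh.
Qed.

Canonical comm_equiv_rel :=
  EquivRel comm_rel comm_rel_refl comm_rel_sym comm_rel_trans.

Definition Comm := {eq_quot comm_equiv_rel}.

HB.instance Definition _ := Choice.on Comm.
HB.instance Definition _ := EqQuotient.on Comm.

Definition comm_class f : Comm := \pi_Comm f.

Lemma comm_classP f g : comm_class f = comm_class g <-> comm_equiv f g.
Proof.
by split=> [/eqmodP/asboolP|fg] //; apply/eqmodP; apply/asboolP.
Qed.

Lemma comm_class_repr f : comm_equiv (repr (comm_class f)) f.
Proof. by apply/comm_classP; rewrite /comm_class reprK. Qed.

Definition Comm_mul (c d : Comm) := comm_class (comm_comp (repr c) (repr d)).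
Definition Comm_inv (c : Comm) := comm_class (comm_inv (repr c)).

Lemma Comm_mulE f g :
  Comm_mul (comm_class f) (comm_class g) = comm_class (comm_comp f g).
Proof. by apply/comm_classP/comm_comp_equiv; exact: comm_class_repr. Qed.

Lemma Comm_invE f : Comm_inv (comm_class f) = comm_class (comm_inv f).
Proof. by apply/comm_classP/comm_inv_equiv; exact: comm_class_repr. Qed.

Lemma Comm_ind (P : Comm -> Prop) : (forall f, P (comm_class f)) -> forall c, P c.
Proof. by move=> Pf c; rewrite -[c]reprK; exact: Pf. Qed.

Lemma Comm_mulA : associative Comm_mul.
Proof.
elim/Comm_ind=> f; elim/Comm_ind=> g; elim/Comm_ind=> h.
by rewrite !Comm_mulE; apply/comm_classP; exact: comm_compA.
Qed.

Lemma Comm_mul1 : left_id (comm_class comm_id) Comm_mul.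
Proof.
by elim/Comm_ind=> f; rewrite Comm_mulE; apply/comm_classP/comm_comp_id.
Qed.

Lemma Comm_mulr1 : right_id (comm_class comm_id) Comm_mul.
Proof.
by elim/Comm_ind=> f; rewrite Comm_mulE; apply/comm_classP/comm_compid.
Qed.

Lemma Comm_mulV : left_inverse (comm_class comm_id) Comm_inv Comm_mul.
Proof.
elim/Comm_ind=> f; rewrite Comm_invE Comm_mulE.
exact/comm_classP/comm_comp_inv.
Qed.

Lemma Comm_mulrV : right_inverse (comm_class comm_id) Comm_inv Comm_mul.
Proof.
elim/Comm_ind=> f; rewrite Comm_invE Comm_mulE.
exact/comm_classP/comm_compV.
Qed.

HB.instance Definition _ := isGroup.Build Comm
  Comm_mulA Comm_mul1 Comm_mulr1 Comm_mulV Comm_mulrV.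

End Operations.

Arguments Comm G : clear implicits.

Section Action.
Variable G : groupType.

Definition comm_act (o : left_order G) (f : commensuration G) : left_order G :=
  lo_extend o (lo_image (comm_iso f) (lo_restr (dom f) o)).

(* The right action of [Comm G]; when [G] is torsion-free locally nilpotent *)
(* the result does not depend on the representative.                        *)
Definition Comm_act (o : left_order G) (c : Comm G) : left_order G :=
  comm_act o (repr c).

End Action.

(* Main.v *)
Require Import Defs.
From mathcomp Require Import all_boot.
From HB Require Import structures.
From mathcomp Require Import boolp classical_sets cardinality.

Set Implicit Arguments.
Unset Strict Implicit.
Unset Printing Implicit Defensive.

Local Open Scope classical_set_scope.
Local Open Scope group_scope.
Local Open Scope quotient_scope.

Local Notation hom := UMagmaMorphism.type.

(**
If two commensurations [f] and [g] act in the same way on left orders, then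
for every [x] where both are defined, [f x] and [g x] have the same sign in
every left order of [G] (up to restricting to a subgroup of finite index).
The proof turns this into an equation between [f x] and [g x].

Left orders are plentiful.  In a torsion-free locally nilpotent group, every
subsemigroup that avoids 1 lies in the positive cone of a left order
([semigroup_extends_to_order]).  Hence orders extend from subgroups, which
makes the action transport signs along commensurations ([comm_act_maps]); and
if the semigroup generated by [a] and the inverse of [b] avoids 1, some order
separates the signs of [a] and [b].  So for [a = f x] and [b = g x] a positive
word in [a] and [b^-1] is trivial.  By induction along the upper central series
this forces [a] and [b] to commute, and then [a ^+ n = b ^+ m] with [n] and [m]
positive ([commensurable_of_positive_word]).

Such a pair of embeddings is rigid ([homs_with_commensurable_values_agree]).
The ratio [m / n] is the same for two independent commuting elements, as one
sees from their product.  In a nonabelian nilpotent group pick [u] and [v] whose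
commutator [z] is central and nontrivial: [u], [v] and [z] share a ratio [r],
while bilinearity of the commutator gives [z] the ratio [r ^ 2].  So [r = 1], and
uniqueness of roots gives [f z = g z].  Central elements carry this to
the whole group.

The extension theorem is the long part.  By Zorn's lemma take a maximal
semigroup [P] that avoids 1.  If neither [y] nor [y^-1] is in [P], maximality gives
a trivial positive word in [P] and [y], and another in [P] and [y^-1].  In the
nilpotent group generated by the letters, both words together show that every
element has, up to commutators, a positive power in [P].  The key lemma
[semigroup_root_of_abelianized] removes the words 'up to commutators', so a
power of 1, that is 1 itself, lies in [P]: a contradiction.

For the key lemma one descends the lower central series and may assume that
each [g] has a power in [S] up to an element of its last term [Z].  Multiplying
such powers of [u], [v] and their inverses in commutator order produces
elements of [S] of the form [D ^+ n * c ^+ N], where [c] is the commutator of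
[u] and [v] or its inverse, and [N] grows quadratically in [n].  So [D] times
any power of [c] has a positive power in [S].  Since [Z] is generated by finitely
many commutators, one [D] serves all of [Z]; and as [D * z] ranges over the whole
group [Z], all elements of [Z] have positive powers in [S].
*)

(** * Subgroups as sets, and quotients *)

Section SubgroupSet.
Variable G : groupType.
Implicit Types A B : set G.

(** The lower central series and generated subgroups are bare sets, whereas
    membership in a [groupClosed] is a boolean predicate; [subgroup_of_set]
    passes from the former to the latter. *)
Record subgroup_set A : Prop := SubgroupSet {
  subset1 : A 1;
  subsetM : forall x y, A x -> A y -> A (x * y);
  subsetV : forall x, A x -> A x^-1
}.

Definition semigroup_set A := forall x y, A x -> A y -> A (x * y).

Definition normal_set A := forall x g, A x -> A (x ^ g).

Section Pred.
Variables (A : set G) (sA : subgroup_set A).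

(** The proof is an argument because the closure instances below are keyed on
    this constant and must find it in its arguments. *)
Definition subgroup_pred of subgroup_set A : {pred G} := fun x => `[< A x >].
Local Notation P := (subgroup_pred sA).

Let PM : mulg_closed P.
Proof. by move=> x y /asboolP Ax /asboolP Ay; exact/asboolP/(subsetM sA). Qed.
Let P1 : 1 \in P. Proof. exact/asboolP/(subset1 sA). Qed.
Let PV : invg_closed P.
Proof. by move=> x /asboolP Ax; exact/asboolP/(subsetV sA). Qed.
HB.instance Definition _ := isMulClosed.Build G P PM.
HB.instance Definition _ := isMul1Closed.Build G P P1.
HB.instance Definition _ := isInvClosed.Build G P PV.
End Pred.

Definition subgroup_of_set A (sA : subgroup_set A) : groupClosed G :=
  subgroup_pred sA.

Lemma in_subgroup_of_set A (sA : subgroup_set A) x :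
  x \in subgroup_of_set sA <-> A x.
Proof. by split=> /asboolP. Qed.

Lemma gen_subgroup A : subgroup_set (gen A).
Proof.
split=> [H _|x y Ax Ay H AH|x Ax H AH]; first exact: gpred1.
  by rewrite gpredM ?Ax ?Ay.
by rewrite gpredV Ax.
Qed.

Lemma sub_gen A : A `<=` gen A.
Proof. by move=> x Ax H; exact. Qed.

Lemma gen_min A B : subgroup_set B -> A `<=` B -> gen A `<=` B.
Proof.
move=> sB AB x Ax; apply/(in_subgroup_of_set sB)/Ax => a /AB.
by move/(in_subgroup_of_set sB).
Qed.

Lemma gen_conj A : (forall x g, A x -> gen A (x ^ g)) -> normal_set (gen A).
Proof.
move=> AJ x g; move: x; apply: gen_min => [|x Ax]; last exact: AJ.
have sA := gen_subgroup A; split=> [|x y|x] /=.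
- by rewrite conj1g; exact: subset1.
- by rewrite conjMg; exact: subsetM.
- by rewrite conjVg; exact: subsetV.
Qed.

End SubgroupSet.

Section Quotient.
Variables (G : groupType) (K : set G) (sK : subgroup_set K) (nK : normal_set K).

Let r : rel G := fun x y => `[< K (x^-1 * y) >].
Let r_refl : reflexive r.
Proof. by move=> x; apply/asboolP; rewrite mulVg; exact: subset1. Qed.
Let r_impl x y : r x y -> r y x.
Proof.
by move=> /asboolP/(subsetV sK); rewrite invgM invgK => ?; exact/asboolP.
Qed.
Let r_sym : symmetric r.
Proof. by move=> x y; apply/idP/idP; exact: r_impl. Qed.
Let r_trans : transitive r.
Proof.
move=> y x z /asboolP xy /asboolP yz; apply/asboolP.
by rewrite -[z](mulVKg y) mulgA; exact: subsetM.
Qed.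
Let e := EquivRel r r_refl r_sym r_trans.
Let Q := {eq_quot e}.

Let eqQ x y : \pi_Q x = \pi_Q y <-> K (x^-1 * y).
Proof. by split=> [/eqmodP/asboolP|xy] //; apply/eqmodP; apply/asboolP. Qed.

Let eqM x x' y y' : \pi_Q x = \pi_Q x' -> \pi_Q y = \pi_Q y' ->
  \pi_Q (x * y) = \pi_Q (x' * y').
Proof.
move=> /eqQ xx' /eqQ yy'; apply/eqQ.
have -> : (x * y)^-1 * (x' * y') = (x^-1 * x') ^ y * (y^-1 * y').
  by rewrite conjgE invgM !mulgA mulgK.
by apply: subsetM => //; exact: nK.
Qed.
Let eqV x x' : \pi_Q x = \pi_Q x' -> \pi_Q x^-1 = \pi_Q x'^-1.
Proof.
move=> /eqQ xx'; apply/eqQ; rewrite invgK.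
have -> : x * x'^-1 = ((x^-1 * x')^-1) ^ x^-1.
  by rewrite conjgE invgM !invgK !mulgA mulgK.
exact/nK/(subsetV sK).
Qed.

Definition coset_mul (x y : Q) : Q := \pi_Q (repr x * repr y).
Definition coset_inv (x : Q) : Q := \pi_Q (repr x)^-1.
Let mulqE x y : coset_mul (\pi_Q x) (\pi_Q y) = \pi_Q (x * y).
Proof. by apply: eqM; rewrite reprK. Qed.
Let invqE x : coset_inv (\pi_Q x) = \pi_Q x^-1.
Proof. by apply: eqV; rewrite reprK. Qed.

Let mulqA : associative coset_mul.
Proof.
elim/quotW=> x; elim/quotW=> y; elim/quotW=> z.
by rewrite (mulqE y z) (mulqE x (y * z)) (mulqE x y) (mulqE (x * y) z) mulgA.
Qed.
Let mul1q : left_id (\pi_Q 1) coset_mul.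
Proof. by elim/quotW=> x; rewrite mulqE mul1g. Qed.
Let mulq1 : right_id (\pi_Q 1) coset_mul.
Proof. by elim/quotW=> x; rewrite mulqE mulg1. Qed.
Let mulVq : left_inverse (\pi_Q 1) coset_inv coset_mul.
Proof. by elim/quotW=> x; rewrite invqE mulqE mulVg. Qed.
Let mulqV : right_inverse (\pi_Q 1) coset_inv coset_mul.
Proof. by elim/quotW=> x; rewrite invqE mulqE mulgV. Qed.

Let T : Type := Q.
HB.instance Definition _ := Choice.on T.
HB.instance Definition _ := isGroup.Build T mulqA mul1q mulq1 mulVq mulqV.

Let p (x : G) : T := \pi_Q x.
Let pM : monoid_morphism p.
Proof. by split=> // x y; rewrite /p -mulqE. Qed.
HB.instance Definition _ := isUMagmaMorphism.Build G T p pM.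

(** The quotient is used only through a surjection with prescribed kernel, so
    its construction stays local. *)
Lemma quotient_exists : exists (Q : groupType) (p : hom G Q),
  (forall q, exists x, p x = q) /\ (forall x, p x = 1 <-> K x).
Proof.
exists T, p; split=> [q|x]; first by exists (repr (q : Q)); exact: (reprK (q : Q)).
rewrite /= /p; split=> [/esym/eqQ|Kx]; first by rewrite invg1 mul1g.
by apply/esym/eqQ; rewrite invg1 mul1g.
Qed.

End Quotient.

(** * Nilpotent groups *)

Section LowerCentral.
Variable N : groupType.
Local Notation lc := (@lower_central N).

Lemma lower_central_subgroup n : subgroup_set (lc n).
Proof. by case: n => [|n]; [split | exact: gen_subgroup]. Qed.

Lemma lower_centralR n x y : lc n x -> lc n.+1 [~ x, y].
Proof. by move=> nx; apply: sub_gen; exists x => //; exists y. Qed.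

Lemma lower_centralS n : lc n.+1 `<=` lc n.
Proof.
elim: n => // n IHn; apply: gen_min; first exact: lower_central_subgroup.
by move=> _ [x nx [y _ <-]]; apply: lower_centralR; exact: IHn.
Qed.

Lemma lower_central_normal n : normal_set (lc n).
Proof.
case: n => // n; apply: gen_conj => _ g [x nx [y _ <-]].
rewrite conjRg; apply: lower_centralR.
have -> : x ^ g = x * [~ x, g] by rewrite mulVKg.
apply: (subsetM (lower_central_subgroup n)) => //.
exact/lower_centralS/lower_centralR.
Qed.

Lemma commutator_in_derived x y : lc 1 [~ x, y].
Proof. exact: lower_centralR. Qed.

End LowerCentral.

Lemma hom_lower_central (N Q : groupType) (p : hom N Q) n x :
  lower_central n x -> lower_central n (p x).
Proof.
elim: n x => // n IHn x.
suff : @lower_central N n.+1 `<=` [set x | lower_central n.+1 (p x)] by apply.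
apply: gen_min => {x}.
  have s := @lower_central_subgroup Q n.+1.
  split=> [|x y|x]; rewrite /= ?gmulf1 ?gmulfM ?gmulfV.
  - exact: subset1 s.
  - exact: subsetM s _ _.
  - exact: subsetV s _.
move=> _ [x nx [y _ <-]] /=; rewrite gmulfR; apply: lower_centralR; exact: IHn.
Qed.

Lemma surj_lower_central (N Q : groupType) (p : hom N Q) n :
  (forall q, exists x, p x = q) ->
  forall q : Q, lower_central n q -> exists2 x, lower_central n x & p x = q.
Proof.
move=> pS; elim: n => [|n IHn] q; first by have [x] := pS q; exists x.
suff : @lower_central Q n.+1 `<=` [set q | exists2 x, lower_central n.+1 x & p x = q].
  by apply.
have s := @lower_central_subgroup N n.+1.
apply: gen_min => {q} [|_ [q /IHn[x nx <-] [q' _ <-]]].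
  split=> [|_ _ [x nx <-] [y ny <-]|_ [x nx <-]] /=.
  - by exists 1; [exact: (subset1 s) | exact: gmulf1].
  - by exists (x * y); [exact: (subsetM s) | exact: gmulfM].
  - by exists x^-1; [exact: (subsetV s) | exact: gmulfV].
have [y <-] := pS q'; exists [~ x, y]; last exact: gmulfR.
exact: lower_centralR.
Qed.

Definition nilpotent_le (n : nat) (N : groupType) :=
  forall x : N, lower_central n x -> x = 1.

Lemma nilpotent_leP (N : groupType) :
  nilpotent_group N <-> exists n, nilpotent_le n N.
Proof.
split=> -[n Nn]; exists n; first by move=> x; rewrite Nn.
apply/seteqP; split=> [x /Nn //|_ ->].
exact: (subset1 (lower_central_subgroup N n)).
Qed.

(** Both inductions on the nilpotency class below quotient by a subgroup that
    contains the last term of the lower central series: the center, or that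
    term itself. *)
Lemma quotient_nilpotent_le (N : groupType) n (K : set N) :
  subgroup_set K -> normal_set K -> lower_central n `<=` K ->
  exists (Q : groupType) (p : hom N Q), [/\ forall q, exists x, p x = q,
    forall x, p x = 1 <-> K x & nilpotent_le n Q].
Proof.
move=> sK nK nleK; have [Q [p [pS pK]]] := quotient_exists sK nK.
exists Q, p; split=> // _ /(surj_lower_central pS)[x /nleK ? <-].
exact/pK.
Qed.

Section Center.
Variable N : groupType.

Definition central : set N := [set z | forall x, commute z x].

Lemma central_subgroup : subgroup_set central.
Proof.
split=> [x|y z yC zC x|z zC x]; first exact/commute_sym/commute1.
  by apply: commute_sym; apply: commuteM; apply: commute_sym.
by apply/commute_sym/commuteV/commute_sym.
Qed.

Lemma central_normal : normal_set central.
Proof. by move=> z g zC; rewrite conjgE zC mulgA mulVg mul1g. Qed.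

Lemma nilpotent_le_central n : nilpotent_le n.+1 N -> lower_central n `<=` central.
Proof. by move=> Nn x nx y; apply/commgP/eqP/Nn/lower_centralR. Qed.

Lemma commXg (x y : N) n :
  commute [~ x, y] x -> [~ x ^+ n, y] = [~ x, y] ^+ n.
Proof.
move=> c; apply: (@mulgI _ (x ^+ n)).
by rewrite mulVKg conjXg -expgMn ?mulVKg //; exact: commute_sym.
Qed.

End Center.
Arguments central {N} _.

Lemma center_quotient (N : groupType) n : nilpotent_le n.+1 N ->
  exists (Q : groupType) (p : hom N Q), [/\ forall q, exists x, p x = q,
    forall x, p x = 1 <-> central x & nilpotent_le n Q].
Proof.
move=> /nilpotent_le_central; apply: quotient_nilpotent_le.
  exact: central_subgroup.
exact: central_normal.
Qed.

Lemma hom_eq (N Q : groupType) (p : hom N Q) x y : p x = p y <-> p (x^-1 * y) = 1.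
Proof.
rewrite gmulfM gmulfV; split=> [->|/mulg1_eq]; first by rewrite mulVg.
by rewrite invgK.
Qed.

Lemma hom_commute_central (N Q : groupType) (p : hom N Q) x y :
  (forall x, p x = 1 <-> central x) -> commute (p x) (p y) -> central [~ x, y].
Proof. by move=> pK /commgP/eqP; rewrite -gmulfR => /pK. Qed.

(** If [z ^+ k] is central and [z] is central modulo the center, then
    [[~ z, g] ^+ k = [~ z ^+ k, g] = 1] with [[~ z, g]] central, so [z] is
    already central.  It suffices that the center has no torsion, which is what
    the induction in the next lemma provides. *)
Lemma center_quotient_center_tf (N Q : groupType) (p : hom N Q) :
  (forall q, exists x, p x = q) -> (forall x, p x = 1 <-> central x) ->
  (forall (z : N) k, central z -> (0 < k)%N -> z ^+ k = 1 -> z = 1) ->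
  forall (q : Q) k, central q -> (0 < k)%N -> q ^+ k = 1 -> q = 1.
Proof.
move=> pS pK Ztf q k + k0; have [z <-] := pS q => zC.
rewrite -gmulfXn => /pK zkC; apply/pK => g.
have zgC : central [~ z, g].
  by apply: hom_commute_central pK _; exact: zC.
apply/commgP/eqP; apply: Ztf k0 _ => //.
rewrite -commXg //; apply/eqP/commgP; exact: zkC.
Qed.

Lemma torsion_free_of_center n (N : groupType) : nilpotent_le n N ->
  (forall (z : N) k, central z -> (0 < k)%N -> z ^+ k = 1 -> z = 1) ->
  torsion_free N.
Proof.
elim: n N => [|n IHn] N Nn Ztf; first by move=> x k _ _; exact: Nn.
have [Q [p [pS pK Qn]]] := center_quotient Nn.
have Qtf : torsion_free Q by apply: IHn => //; exact: center_quotient_center_tf.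
move=> x k k0 xk1; apply: Ztf (k0) (xk1); apply/pK.
by apply: Qtf k0 _; rewrite -gmulfXn xk1 gmulf1.
Qed.

Lemma center_quotient_tf (N : groupType) n :
  nilpotent_le n.+1 N -> torsion_free N ->
  exists (Q : groupType) (p : hom N Q), [/\ forall q, exists x, p x = q,
    forall x, p x = 1 <-> central x, nilpotent_le n Q & torsion_free Q].
Proof.
move=> Nn Ntf; have [Q [p [pS pK Qn]]] := center_quotient Nn.
exists Q, p; split=> //; apply: torsion_free_of_center (Qn) _.
by apply: center_quotient_center_tf pS pK _ => z k _; exact: Ntf.
Qed.

(** Modulo the center [x] and [y] commute by induction; then [[~ x, y]] is
    central and its [k]-th power is [[~ x ^+ k, y] = 1]. *)
Lemma commute_root n (N : groupType) (x y : N) k :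
  nilpotent_le n N -> torsion_free N -> (0 < k)%N ->
  commute (x ^+ k) y -> commute x y.
Proof.
elim: n N x y => [|n IHn] N x y Nn Ntf k0 xky.
  by rewrite (Nn x) //; exact/commute_sym/commute1.
have [Q [p [pS pK Qn Qtf]]] := center_quotient_tf Nn Ntf.
have xyC : central [~ x, y].
  apply: hom_commute_central pK _; apply: IHn k0 _ => //.
  by rewrite -gmulfXn; exact: gmulf_commute.
apply/commgP/eqP/(Ntf _ _ k0); rewrite -commXg //; exact/eqP/commgP.
Qed.

(** * Subsemigroups of finitely generated nilpotent groups *)

Section CommutatorIdentities.
Variable N : groupType.
Implicit Types x y z : N.

Lemma commMg x y z : [~ x * y, z] = [~ x, z] ^ y * [~ y, z].
Proof. by rewrite !commgEl !conjgE !invgM !mulgA !mulgK. Qed.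

Lemma commgM x y z : [~ x, y * z] = [~ x, z] * [~ x, y] ^ z.
Proof. by rewrite !commgEl !conjgE !invgM !mulgA !mulgK. Qed.

Lemma commVg x y : [~ x^-1, y] = ([~ x, y] ^ x^-1)^-1.
Proof. by apply/esym/mulg1_eq; rewrite -commMg mulgV comm1g. Qed.

Lemma commgV x y : [~ x, y^-1] = ([~ x, y] ^ y^-1)^-1.
Proof. by rewrite !commgEl !conjgE !invgM !invgK !mulgA mulgV mul1g. Qed.

Lemma commgX x y n : commute [~ x, y] y -> [~ x, y ^+ n] = [~ x, y] ^+ n.
Proof.
move=> c; apply: invg_inj; rewrite invgR commXg; last first.
  by rewrite -invgR; apply/commute_sym/commuteV/commute_sym.
by rewrite -invgR expVgn.
Qed.

Lemma commXgX x y n m : commute [~ x, y] x -> commute [~ x, y] y ->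
  [~ x ^+ n, y ^+ m] = [~ x, y] ^+ (n * m).
Proof.
move=> cx cy; rewrite commXg; last first.
  by rewrite commgX //; apply/commute_sym/commuteX/commute_sym.
by rewrite commgX // -expgnA mulnC.
Qed.

End CommutatorIdentities.

Section FiniteGeneration.
Variables (N : groupType) (X : seq N).
Hypothesis genX : setT `<=` gen [set` X].
Local Notation lc := (@lower_central N).

(** Modulo the next term, the commutator is bilinear, so commutators of
    generators generate. *)
Lemma lower_central_fg_step n (L : seq N) :
    (forall c, c \in L -> lc n c) -> lc n `<=` gen ([set` L] `|` lc n.+1) ->
  lc n.+1 `<=` gen ([set` [seq [~ c, x] | c <- L, x <- X]] `|` lc n.+2).
Proof.
move=> Ln genL; set A := [set` _] `|` _; pose J := gen A.
have sJ : subgroup_set J := gen_subgroup A.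
have Jn2 x : lc n.+2 x -> J x by move=> ?; apply: sub_gen; right.
have Jn1 : J `<=` lc n.+1.
  apply: gen_min; first exact: lower_central_subgroup.
  move=> x [/allpairsP[[c y] /= [cL _ ->]]|]; last exact: lower_centralS.
  by apply/lower_centralR/Ln.
have nJ : normal_set J.
  move=> x g Jx; have -> : x ^ g = x * [~ x, g] by rewrite mulVKg.
  by apply: (subsetM sJ) => //; apply/Jn2/lower_centralR/Jn1.
have JL c y : c \in L -> J [~ c, y].
  move=> cL; have := genX (I : setT y); move: y.
  apply: gen_min => [|y yX]; last first.
    by apply: sub_gen; left; apply/allpairsP; exists (c, y).
  split=> [|x y Jx Jy|x Jx] /=.
  - by rewrite commg1; exact: (subset1 sJ).
  - by rewrite commgM; apply: (subsetM sJ) => //; exact: nJ.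
  - by rewrite commgV; apply/(subsetV sJ)/nJ.
apply: gen_min => // _ [u nu [v _ <-]]; move: v.
suff : lc n `<=` [set u | forall v, J [~ u, v]] by exact.
move=> {u nu}; apply: (subset_trans genL); apply: gen_min => [|u [uL v|nu v]].
- split=> [v|x y Jx Jy v|x Jx v] /=.
  + by rewrite comm1g; exact: (subset1 sJ).
  + by rewrite commMg; apply: (subsetM sJ) => //; exact: nJ.
  + by rewrite commVg; apply/(subsetV sJ)/nJ.
- exact: JL.
- exact/Jn2/lower_centralR.
Qed.

Lemma lower_central_fg n : exists L : seq N,
  (forall c, c \in L -> lc n c) /\ lc n `<=` gen ([set` L] `|` lc n.+1).
Proof.
elim: n => [|n [L [Ln genL]]].
  exists X; split=> //; apply: (subset_trans genX).
  apply: gen_min; first exact: gen_subgroup.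
  by move=> y yX; apply: sub_gen; left.
exists [seq [~ c, x] | c <- L, x <- X]; split.
  by move=> _ /allpairsP[[c y] /= [cL _ ->]]; exact/lower_centralR/Ln.
exact: lower_central_fg_step.
Qed.

(** The generators are kept as pairs because the cone argument below also needs
    the entries of each commutator. *)
Lemma last_lower_central_fg n : nilpotent_le n.+2 N -> exists L : seq (N * N),
  (forall c, c \in L -> lc n.+1 [~ c.1, c.2]) /\
  lc n.+1 `<=` gen [set` [seq [~ c.1, c.2] | c <- L]].
Proof.
move=> Nn; have [L [Ln genL]] := lower_central_fg n.
exists [seq (c, x) | c <- L, x <- X]; split.
  by move=> _ /allpairsP[[c y] /= [cL _ ->]]; exact/lower_centralR/Ln.
apply: (subset_trans (lower_central_fg_step Ln genL)); apply: gen_min.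
  exact: gen_subgroup.
move=> y [/allpairsP[[c x] /= [cL xX ->]]|/Nn->]; last first.
  exact: (subset1 (gen_subgroup _)).
by apply: sub_gen; apply/mapP; exists (c, x) => //; apply/allpairsP; exists (c, x).
Qed.

End FiniteGeneration.

(** In this section every element of [N] has a positive power in [S] up to an
    element of the central subgroup [Z]; the goal is to get rid of [Z] when it
    is generated by finitely many commutators. *)
Section CentralCone.
Variables (N : groupType) (S Z : set N).
Hypothesis SM : semigroup_set S.
Hypothesis sZ : subgroup_set Z.
Hypothesis ZC : Z `<=` central.
Hypothesis rootSZ : forall g, exists k z, [/\ (0 < k)%N, Z z & S (g ^+ k * z)].

Lemma semigroupX x n : S x -> (0 < n)%N -> S (x ^+ n).
Proof. by move=> Sx; elim: n => // -[//|n] IHn _; rewrite expgS; apply/SM/IHn. Qed.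

Lemma subgroupX z n : Z z -> Z (z ^+ n).
Proof.
by move=> Zz; elim: n => [|n IHn]; rewrite ?expgS; [exact: (subset1 sZ) | exact: (subsetM sZ)].
Qed.

Lemma expgMn_central x z n : Z z -> (x * z) ^+ n = x ^+ n * z ^+ n.
Proof. by move=> Zz; apply: expgMn; exact/commute_sym/ZC. Qed.

Lemma rootSZ_mul g k z l : Z z -> S (g ^+ k * z) -> (0 < l)%N ->
  S (g ^+ (k * l) * z ^+ l).
Proof.
move=> Zz Sg l0; by rewrite expgnA -expgMn_central //; exact: semigroupX.
Qed.

Lemma rootSZ_pair g h : exists k z w,
  [/\ (0 < k)%N, Z z, Z w, S (g ^+ k * z) & S (h ^+ k * w)].
Proof.
have [k [z [k0 Zz Sg]]] := rootSZ g; have [l [w [l0 Zw Sh]]] := rootSZ h.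
exists (k * l)%N, (z ^+ l), (w ^+ k); rewrite muln_gt0 k0 l0; split=> //.
- exact: subgroupX.
- exact: subgroupX.
- exact: rootSZ_mul.
- by rewrite mulnC; exact: rootSZ_mul.
Qed.

(** One exponent [k] for all four elements makes the powers of [u] and [v]
    cancel in the commutator word below. *)
Lemma rootSZ_inv_pair u v : exists k z1 z2 w1 w2,
  [/\ (0 < k)%N, [/\ Z z1, Z z2, Z w1 & Z w2],
   S (u ^+ k * z1) /\ S (u^-1 ^+ k * z2) & S (v ^+ k * w1) /\ S (v^-1 ^+ k * w2)].
Proof.
have [k [z1 [z2 [k0 Z1 Z2 S1 S2]]]] := rootSZ_pair u u^-1.
have [l [w1 [w2 [l0 W1 W2 T1 T2]]]] := rootSZ_pair v v^-1.
exists (k * l)%N, (z1 ^+ l), (z2 ^+ l), (w1 ^+ k), (w2 ^+ k).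
rewrite muln_gt0 k0 l0; split=> //.
- by split; exact: subgroupX.
- by split; exact: rootSZ_mul.
- by rewrite mulnC; split; exact: rootSZ_mul.
Qed.

Lemma central_mulACA (x y z w : N) : Z y -> x * y * (z * w) = x * z * (y * w).
Proof. by move=> /ZC yC; rewrite !mulgA -[x * y * z]mulgA (yC z) mulgA. Qed.

(** Let [s], [s'], [t], [t'] in [S] be [u ^+ k], [u ^- k], [v ^+ k], [v ^- k] up
    to [Z].  The word [s' ^+ m * t' ^+ m * (s ^+ m * t ^+ m)] is
    [D ^+ m * c ^+ (k * m) ^ 2] with [c = [~ u, v]] and [D] the product of the
    four errors: the error is linear in [m] and the commutator quadratic, so the
    commutator exponent can be made as large as desired relative to that of
    [D]. *)
Lemma commutator_bounded u v : Z [~ u, v] -> exists D, Z D /\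
  forall n, exists2 r, (0 < r)%N & S ((D * [~ u, v] ^+ n) ^+ r).
Proof.
move=> Zc; have cC := ZC Zc.
have [k [z1 [z2 [w1 [w2 [k0 [Z1 Z2 W1 W2] [S1 S2] [T1 T2]]]]]]] := rootSZ_inv_pair u v.
pose D := z2 * w2 * (z1 * w1).
have ZD : Z D by rewrite /D; do !apply: (subsetM sZ).
have SD : S D.
  have -> : D = (u^-1 ^+ k * z2) * (u ^+ k * z1) * ((v^-1 ^+ k * w2) * (v ^+ k * w1)).
    rewrite [in RHS](central_mulACA _ _ _ Z2) [in RHS](central_mulACA _ _ _ W2).
    by rewrite !expVgn !mulVg !mul1g /D (central_mulACA _ _ _ W2).
  by apply: SM; apply: SM.
exists D; split=> // -[|n]; first by exists 1%N; rewrite ?mulg1.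
set c := [~ u, v].
have SDc m : (0 < m)%N -> S (D ^+ m * c ^+ (k * m * (k * m))).
  move=> m0; set q := (k * m)%N.
  have -> : c ^+ (q * q) = u^-1 ^+ q * v^-1 ^+ q * (u ^+ q * v ^+ q).
    by rewrite -(commXgX q q (cC u) (cC v)) commgEl conjgE !expVgn !mulgA.
  have -> : D ^+ m = z2 ^+ m * w2 ^+ m * (z1 ^+ m * w1 ^+ m).
    rewrite (expgMn_central _ m (subsetM sZ Z1 W1)).
    by rewrite (expgMn_central _ m W2) (expgMn_central _ m W1).
  set z := (X in S X); suff -> : z = (u^-1 ^+ k * z2) ^+ m * (v^-1 ^+ k * w2) ^+ m *
      ((u ^+ k * z1) ^+ m * (v ^+ k * w1) ^+ m).
    by do 2!apply: SM; exact: semigroupX.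
  rewrite (expgMn_central _ m Z1) (expgMn_central _ m Z2).
  rewrite (expgMn_central _ m W1) (expgMn_central _ m W2) -!expgnA.
  rewrite [in RHS](central_mulACA _ _ _ (subgroupX m Z2)).
  rewrite [in RHS](central_mulACA _ _ _ (subgroupX m Z1)).
  rewrite [in RHS](central_mulACA _ _ _ (subsetM sZ (subgroupX m Z2) (subgroupX m W2))).
  apply: ZC; do !apply: (subsetM sZ); exact: subgroupX.
(* This power of [D * c ^+ n.+1] is the word above for [m = n.+1], times a *)
(* power of [D] with nonnegative exponent.                                 *)
exists (k * k * n.+1)%N; first by rewrite !muln_gt0 k0.
rewrite expgMn; last exact: ZC.
rewrite -expgnA; set K := (k * k)%N.
have -> : (K * n.+1 = K.-1 * n.+1 + n.+1)%N.
  by rewrite -mulSnr prednK // muln_gt0 k0.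
have -> : (n.+1 * (K.-1 * n.+1 + n.+1) = k * n.+1 * (k * n.+1))%N.
  by rewrite -mulSnr prednK ?muln_gt0 ?k0 // mulnC -mulnA mulnACA.
rewrite expgnDr -mulgA -[D ^+ _ * (_ * _)]/(_ ^+ _ * _).
case: (K.-1 * n.+1)%N => [|l]; first by rewrite mul1g; exact: SDc.
by apply: SM; [exact: semigroupX | exact: SDc].
Qed.

(** Only nonnegative exponents, because [commutator_bounded] controls one
    direction at a time; inverses enter as additional generators. *)
Fixpoint central_span (L : seq N) : set N :=
  if L is c :: L' then [set c ^+ n * y | n in setT & y in central_span L']
  else [set 1].

(** The product of the elements [D] found for the single generators works for
    all products of their powers. *)
Lemma central_span_bounded (L : seq N) :
    (forall c, c \in L -> Z c /\ exists D, Z D /\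
       forall n, exists2 r, (0 < r)%N & S ((D * c ^+ n) ^+ r)) ->
  exists D, Z D /\
    forall y, central_span L y -> exists2 r, (0 < r)%N & S ((D * y) ^+ r).
Proof.
elim: L => [_|c L IHL LS].
  have [k [z [k0 Zz]]] := rootSZ 1; rewrite expg1n mul1g => Sz.
  by exists z; split=> // _ ->; exists 1%N; rewrite ?mulg1.
have [Zc [D [ZD DS]]] : _ := LS c (mem_head _ _).
have [|E [ZE ES]] := IHL; first by move=> d dL; apply: LS; rewrite inE dL orbT.
exists (D * E); split=> [|_ [n _ [y yL <-]]]; first exact: (subsetM sZ).
have [r r0 Sr] := DS n; have [t t0 St] := ES y yL.
exists (r * t)%N; first by rewrite muln_gt0 r0.
rewrite (central_mulACA _ _ _ ZE) expgMn; last first.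
  by apply/ZC/(subsetM sZ) => //; exact: subgroupX.
by rewrite expgnA mulnC expgnA; apply: SM; exact: semigroupX.
Qed.

Lemma sub_central_span (L : seq N) c y :
  (forall d, d \in L -> central d) -> c \in L ->
  central_span L y -> central_span L (c * y).
Proof.
elim: L y => // d L IHL y LC; rewrite inE => /predU1P[->|cL] [n _ [z zL <-]].
  by exists n.+1 => //; exists z; rewrite // expgS mulgA.
exists n => //; exists (c * z); last first.
  by rewrite !mulgA; congr (_ * _); apply/esym/LC; rewrite inE cL orbT.
by apply: IHL => // e eL; apply: LC; rewrite inE eL orbT.
Qed.

Lemma gen_central_span (L : seq N) : (forall d, d \in L -> central d) ->
  gen [set` L] `<=` central_span (L ++ map inv L).
Proof.
move=> LC; set M := L ++ _.
have MC d : d \in M -> central d.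
  rewrite mem_cat => /orP[/LC //|/mapP[e /LC eC ->]].
  exact: (subsetV (central_subgroup N)).
have M1 : central_span M 1.
  elim: (M) => // c M' IH; exists 0%N => //; exists 1 => //.
  by rewrite mulg1.
pose B := [set x | forall y, central_span M y ->
  central_span M (x * y) /\ central_span M (x^-1 * y)].
suff BL : gen [set` L] `<=` B by move=> x /BL /(_ 1 M1) [+ _]; rewrite mulg1.
apply: gen_min => [|c cL y yM].
  split=> [y yM|x y Bx By z zM|x Bx z /Bx[]]; rewrite /= ?invg1 ?mul1g //.
    rewrite invgM -!mulgA; split.
      by apply: (Bx _ _).1; exact: (By _ _).1.
    by apply: (By _ _).2; exact: (Bx _ _).2.
  by rewrite invgK.
split; apply: sub_central_span => //; rewrite mem_cat ?cL //.
by rewrite map_f ?orbT.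
Qed.

(** An element [D] of [Z] such that every [D * y] has a power in [S] settles all
    [z] in [Z], through [y = D^-1 * z]; then the error [z] in [g ^+ k * z] can be
    cancelled inside [S]. *)
Lemma root_in_semigroup (L : seq (N * N)) :
    (forall c, c \in L -> Z [~ c.1, c.2]) ->
    Z `<=` gen [set` [seq [~ c.1, c.2] | c <- L]] ->
  forall g, exists2 k, (0 < k)%N & S (g ^+ k).
Proof.
move=> LZ ZL g; set M := [seq _ | c <- L] in ZL.
have MC d : d \in M -> central d by move=> /mapP[c /LZ ? ->]; exact: ZC.
have [|D [ZD DS]] := @central_span_bounded (M ++ map inv M).
  move=> d; rewrite mem_cat => /orP[/mapP[c cL ->]|/mapP[_ /mapP[c cL ->] ->]].
    by split; [exact: LZ | apply/commutator_bounded/LZ].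
  rewrite invgR; have Zc : Z [~ c.2, c.1].
    by rewrite -invgR; apply/(subsetV sZ)/LZ.
  by split => //; exact: commutator_bounded.
have coneZ z : Z z -> exists2 r, (0 < r)%N & S (z ^+ r).
  move=> Zz; rewrite -[z](mulVKg D); apply/DS/gen_central_span => //.
  by apply/ZL/(subsetM sZ) => //; exact: (subsetV sZ).
have [k [z [k0 Zz Sg]]] := rootSZ g; have [r r0 Sr] := coneZ _ (subsetV sZ Zz).
exists (k * r)%N; first by rewrite muln_gt0 k0.
rewrite expgnA -[g ^+ k](mulgK z) expgMn_central; last exact: (subsetV sZ).
by apply: SM => //; exact: semigroupX.
Qed.

End CentralCone.

(** The semigroup form of the fact that a subgroup which is everything modulo the
    derived subgroup of a nilpotent group is everything.  Induction on the class
    reduces it to an error in the last term of the lower central series. *)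
Lemma semigroup_root_of_abelianized n (N : groupType) (X : seq N) (S : set N) :
    nilpotent_le n.+1 N -> setT `<=` gen [set` X] ->
    semigroup_set S ->
    (forall g, exists k d, [/\ (0 < k)%N, lower_central 1 d & S (g ^+ k * d)]) ->
  forall g, exists2 k, (0 < k)%N & S (g ^+ k).
Proof.
elim: n N X S => [|n IHn] N X S Nn XN SM SN.
  move=> g; have [k [d [k0 /Nn-> Sg]]] := SN g.
  by exists k; rewrite // -[g ^+ k]mulg1.
pose Z := @lower_central N n.+1.
have sZ : subgroup_set Z := lower_central_subgroup N n.+1.
have ZC : Z `<=` central by exact: nilpotent_le_central.
have [L [LZ ZL]] := last_lower_central_fg XN Nn.
apply: (root_in_semigroup SM sZ ZC _ LZ ZL) => g.
have nZ : normal_set Z := @lower_central_normal N n.+1.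
have [Q [p [pS pK Qn]]] := quotient_nilpotent_le sZ nZ (@subset_refl _ _).
have [|||k k0 [s Ss ps]] := IHn Q (map p X) [set p s | s in S] Qn _ _ _ (p g).
- move=> q _; have [x <-] := pS q; have := XN x I; move: x => {q}.
  apply: gen_min => [|x xX]; last by apply: sub_gen; exact: map_f.
  have s := gen_subgroup [set` map p X].
  split=> [|x y|x] /=; rewrite ?gmulf1 ?gmulfM ?gmulfV.
  + exact: (subset1 s).
  + exact: (subsetM s).
  + exact: (subsetV s).
- by move=> _ _ [x Sx <-] [y Sy <-]; exists (x * y); [exact: SM | exact: gmulfM].
- move=> q; have [x <-] := pS q; have [k [d [k0 d1 Sx]]] := SN x.
  exists k, (p d); split=> //; first exact: hom_lower_central.
  by exists (x ^+ k * d); rewrite // gmulfM gmulfXn.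
exists k, (g ^- k * s); split=> //; last by rewrite mulVKg.
by apply/pK/hom_eq; rewrite gmulfXn ps.
Qed.

(** * Extending a semigroup to the positive cone of a left order *)

(** Statements about finitely many elements of [G] are proved in a nilpotent
    group that maps injectively to [G], so that inductions on the class can
    change the ambient group. *)
Lemma fg_subgroup (G : groupType) (s : seq G) : locally_nilpotent G ->
  exists (N : groupType) (i : hom N G) n (X : seq N), [/\ injective i,
    forall x, gen [set` s] (i x), nilpotent_le n N,
    setT `<=` gen [set` X] & map i X = s].
Proof.
move=> ln; pose H := subgroup_of_set (gen_subgroup [set` s]).
have [|n Nn] := (nilpotent_leP (subg_of H)).1.
  apply: ln; exists s; apply/seteqP.
  by split=> x; [move/in_subgroup_of_set | move=> ?; apply/in_subgroup_of_set].
pose X : seq (subg_of H) := pmap insub s.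
have Xs : map val X = s.
  rewrite /X (pmap_filter (insubK _)); apply/all_filterP/allP => x xs.
  by rewrite isSome_insub; apply/in_subgroup_of_set/sub_gen.
have Hgen (x : subg_of H) : gen [set` s] (val x).
  exact/(in_subgroup_of_set (gen_subgroup [set` s]))/subg_valP.
exists (subg_of H), val, n, X; split=> //; first exact: val_inj.
move=> x _; have sX := gen_subgroup [set` X].
have := Hgen x.
suff sub : gen [set` s] `<=` [set y | exists2 z : subg_of H, gen [set` X] z & val z = y].
  by move=> /sub[z Xz /val_inj <-].
apply: gen_min => [|y /=]; last first.
  by rewrite -{1}Xs => /mapP[z zX ->]; exists z => //; exact: sub_gen.
split=> [|_ _ [z Xz <-] [t Xt <-]|_ [z Xz <-]].
- by exists 1; [exact: (subset1 sX) | exact: val1].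
- by exists (z * t); [exact: (subsetM sX) | exact: valM].
- by exists z^-1; [exact: (subsetV sX) | exact: (gmulfV val)].
Qed.

Section Semigroup.
Variable G : groupType.
Implicit Types (S A : set G) (l : seq G).

Definition words A : set (seq G) := [set l | l != [::] /\ forall a, a \in l -> A a].

(** The subsemigroup generated by [A]: nonempty words only, so that it may avoid
    the neutral element. *)
Definition sgen A : set G := [set \prod_(a <- l) a | l in words A].

Lemma sgen_semigroup A : semigroup_set (sgen A).
Proof.
move=> _ _ [l [l0 lA] <-] [m [m0 mA] <-]; exists (l ++ m); last by rewrite big_cat.
split=> [|a]; first by case: (l) l0.
by rewrite mem_cat => /orP[/lA|/mA].
Qed.

Lemma sub_sgen A : A `<=` sgen A.
Proof.
move=> x Ax; exists [:: x]; last by rewrite big_seq1.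
by split=> // a; rewrite inE => /eqP->.
Qed.

Lemma sgen_min A S : semigroup_set S -> A `<=` S -> sgen A `<=` S.
Proof.
move=> SM AS _ [l [l0 lA] <-]; elim: l l0 lA => // a [|b l] IHl _ lA.
  by rewrite big_seq1; apply/AS/lA; rewrite mem_head.
rewrite big_cons; apply: SM; first by apply/AS/lA; rewrite mem_head.
by apply: IHl => // c cl; apply: lA; rewrite inE cl orbT.
Qed.

(** Zorn's lemma is applied to the sets [A] such that [S `|` A] generates a
    semigroup that avoids 1, rather than to semigroups containing [S]: this
    condition also holds for the union of the empty chain. *)
Lemma maximal_semigroup S : semigroup_set S -> ~ S 1 ->
  exists P, [/\ semigroup_set P, S `<=` P, ~ P 1 &
    forall y, ~ P y -> sgen (P `|` [set y]) 1].
Proof.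
move=> SM S1; pose avoids A := ~ sgen (S `|` A) 1.
have [F Fav Ftot|A [A1 Amax]] := @Zorn_bigcup _ avoids.
  move=> [l [l0 lF] l1]; pose U := \bigcup_(X in F) X.
  suff [lS|[X [FX lX]]] : (forall a, a \in l -> S a) \/
      exists X, F X /\ forall a, a \in l -> (S `|` X) a.
  - by apply/S1/(sgen_min SM (@subset_refl _ S)); exists l.
  - by apply: (Fav _ FX); exists l.
  elim: l lF {l0 l1} => [|a l IHl] lF; first by left.
  have {}IHl := IHl (fun b bl => lF b (mem_behead (s := a :: l) bl)).
  have [Sa|[X FX Xa]] := lF a (mem_head _ _).
    case: IHl => [lS|[X [FX lX]]]; [left | right; exists X; split=> //].
      by move=> b; rewrite inE => /predU1P[->|/lS].
    by move=> b; rewrite inE => /predU1P[->|/lX //]; left.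
  right; case: IHl => [lS|[Y [FY lY]]].
    exists X; split=> // b; rewrite inE => /predU1P[->|/lS]; [by right | by left].
  have [XY|YX] := Ftot _ _ FX FY.
    exists Y; split=> // b; rewrite inE => /predU1P[->|/lY //].
    by right; exact: XY.
  exists X; split=> // b; rewrite inE => /predU1P[->|/lY[Sb|/YX Xb]];
    by [right | left].
exists (sgen (S `|` A)); split=> //; first exact: sgen_semigroup.
  by move=> x Sx; apply: sub_sgen; left.
move=> y Py; have /contrapT[l [l0 lA] l1] : ~ avoids (A `|` [set y]).
  apply: Amax; split=> [x Ax|sAy]; first by left.
  by apply/Py/sub_sgen; right; apply: sAy; right.
exists l => //; split=> // a /lA[Sa|[Aa|->]]; last by right.
  by left; apply: sub_sgen; left.
by left; apply: sub_sgen; right.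
Qed.

End Semigroup.

(** Below, [Q] will be the abelianization of [N] and [p] the projection. *)
Section Abelianized.
Variables (N Q : groupType) (p : hom N Q) (S : set N).
Hypothesis QC : forall x y : Q, commute x y.
Hypothesis SM : semigroup_set S.

(* Elements with a positive power in [S] modulo the kernel of [p]. *)
Let E : set N := [set g | exists k s, [/\ (0 < k)%N, S s & p s = p g ^+ k]].

(** The first two cases are exact and not just modulo the kernel of [p]: a word
    without [y] lies in [S], and a word in [y] alone is a power whose triviality
    can be excluded by torsion-freeness. *)
Lemma abelianized_word (y : N) l : (forall a, a \in l -> (S `|` [set y]) a) ->
  [\/ S (\prod_(a <- l) a), \prod_(a <- l) a = y ^+ size l |
      exists q k, S q /\ p (\prod_(a <- l) a) = p q * p y ^+ k.+1].
Proof.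
elim: l => [|b l IHl] lS; first by apply: Or32; rewrite big_nil.
have {}IHl := IHl (fun a al => lS a (mem_behead (s := b :: l) al)).
rewrite big_cons; set w := \prod_(_ <- _) _ in IHl *.
have [Sb|/= ->] := lS b (mem_head _ _).
  case: IHl => [Sw|->|[q [k [Sq wq]]]]; first by apply: Or31; exact: SM.
    case: (l) => [|c m] /=; first by apply: Or31; rewrite mulg1.
    by apply: Or33; exists b, (size m); rewrite gmulfM gmulfXn.
  apply: Or33; exists (b * q), k; split; first exact: SM.
  by rewrite !gmulfM wq mulgA.
case: IHl => [Sw|->|[q [k [Sq wq]]]].
- by apply: Or33; exists w, 0%N; rewrite gmulfM QC.
- by apply: Or32; rewrite -expgS.
- apply: Or33; exists q, k.+1; split=> //.
  by rewrite gmulfM wq QC -mulgA -expgSr.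
Qed.

Lemma abelianized_inv y : torsion_free N -> y <> 1 ->
  sgen (S `|` [set y]) 1 -> S 1 \/ E y^-1.
Proof.
move=> Ntf y1 [l [l0 lS] l1]; have := abelianized_word lS.
rewrite l1 => -[S1|/esym yl|[q [k [Sq qk]]]]; first by left.
  by case: y1; apply: Ntf yl; case: (l) l0.
right; exists k.+1, q; split=> //.
rewrite gmulfV expVgn; apply/esym/mulg1_eq.
by rewrite QC -qk gmulf1.
Qed.

Lemma abelianizedM g h : E g -> E h -> E (g * h).
Proof.
move=> [k [s [k0 Ss sg]]] [l [t [l0 St th]]].
exists (k * l)%N, (s ^+ l * t ^+ k); rewrite muln_gt0 k0; split=> //.
  by apply: SM; exact: semigroupX.
rewrite !gmulfM !gmulfXn sg th -!expgnA [(l * k)%N]mulnC.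
by rewrite expgMn //; exact: QC.
Qed.

(** Rotating a trivial word writes the inverse of each letter as the product of
    the remaining ones. *)
Lemma abelianized_word_inv l : E 1 -> (forall a, a \in l -> E a) ->
  \prod_(a <- l) a = 1 -> forall a, a \in l -> E a^-1.
Proof.
move=> E1 lE l1 a al; have EP m : {subset m <= l} -> E (\prod_(b <- m) b).
  elim: m => [|b m IHm] ml; first by rewrite big_nil.
  rewrite big_cons; apply: abelianizedM; first by apply/lE/ml; rewrite mem_head.
  by apply: IHm => c cm; apply: ml; rewrite inE cm orbT.
case/splitPr: al l1 EP lE => u v; rewrite big_cat big_cons => uav EP _.
suff -> : a^-1 = \prod_(b <- v) b * \prod_(b <- u) b.
  by apply: abelianizedM; apply: EP => b; rewrite mem_cat inE => ->; rewrite ?orbT.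
apply: mulg1_eq; rewrite mulgA; apply: (@mulgI _ (\prod_(b <- u) b)).
by rewrite mulgA uav mulg1 mul1g.
Qed.

End Abelianized.

(** A trivial word in [S] and [y] gives [y^-1] a positive power in [S]
    modulo the derived subgroup, one in [S] and [y^-1] does so for [y]; by rotation the
    inverses of all letters have one too, hence so has every element, and the key lemma
    applied to 1 puts 1 in [S]. *)
Lemma semigroup_dichotomy n (N : groupType) (S : set N) (y : N) (l m : seq N) :
    nilpotent_le n N -> torsion_free N -> semigroup_set S -> y <> 1 ->
    setT `<=` gen [set` y :: l ++ m] ->
    words (S `|` [set y]) l -> \prod_(a <- l) a = 1 ->
    words (S `|` [set y^-1]) m -> \prod_(a <- m) a = 1 ->
  S 1.
Proof.
move=> Nn Ntf SM y1 Ngen lS l1 mS m1.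
have [Q [p [pS pK Q1]]] := quotient_nilpotent_le (lower_central_subgroup N 1)
  (@lower_central_normal N 1) (@subset_refl _ _).
have QC (a b : Q) : commute a b by apply/commgP/eqP/Q1/commutator_in_derived.
have [//|Ey'] : S 1 \/ _ := abelianized_inv p QC SM Ntf y1 (ex_intro2 _ _ l lS l1).
have y'1 : y^-1 <> 1 by move=> /(congr1 inv); rewrite invgK invg1.
have [//|] : S 1 \/ _ := abelianized_inv p QC SM Ntf y'1 (ex_intro2 _ _ m mS m1).
rewrite invgK => Ey; set E := [set g | _] in Ey Ey'.
have EM a b : E a -> E b -> E (a * b) by exact: abelianizedM.
have E1 : E 1 by rewrite -(mulgV y); exact: EM.
have ES a : S a -> E a by move=> Sa; exists 1%N, a.
have lE a : a \in l -> E a by move=> /lS.2[/ES|->].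
have mE a : a \in m -> E a by move=> /mS.2[/ES|->].
have EN g : E g.
  suff : setT `<=` [set g | E g /\ E g^-1] by move=> /(_ g I)[].
  apply: (subset_trans Ngen); apply: gen_min.
    split=> [|a b [Ea Ea'] [Eb Eb']|a [Ea Ea']] /=; rewrite ?invg1 ?invgM ?invgK //.
    by split; exact: EM.
  move=> a /=; rewrite inE mem_cat => /predU1P[->|/orP[al|am]]; first by split.
    by split; [exact: lE | exact: (abelianized_word_inv QC SM E1 lE l1 al)].
  by split; [exact: mE | exact: (abelianized_word_inv QC SM E1 mE m1 am)].
have [||k _] := semigroup_root_of_abelianized (n := n) _ Ngen SM _ 1.
- by move=> x /lower_centralS/Nn.
- move=> g; have [k [s [k0 Ss sg]]] := EN g; exists k, (g ^- k * s); split=> //.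
    by apply/pK/hom_eq; rewrite gmulfXn sg.
  by rewrite mulVKg.
- by rewrite expg1n.
Qed.

Section ExtendOrder.
Variable G : groupType.
Hypotheses (tf : torsion_free G) (ln : locally_nilpotent G).

Lemma maximal_semigroup_total (P : set G) : semigroup_set P -> ~ P 1 ->
  (forall y, ~ P y -> sgen (P `|` [set y]) 1) ->
  forall y, y <> 1 -> P y \/ P y^-1.
Proof.
move=> PM P1 Pmax y y1; apply: contrapT => /not_orP[/Pmax[l lP l1] /Pmax[m mP m1]].
have [N [i [n [X [i_inj _ Nn Xgen]]]]] := fg_subgroup (y :: l ++ m) ln.
case: X Xgen => // x X Xgen [xy Xlm].
pose l' := take (size l) X; pose m' := drop (size l) X.
have l'l : map i l' = l by rewrite map_take Xlm take_size_cat.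
have m'm : map i m' = m by rewrite map_drop Xlm drop_size_cat.
have prodE (s : seq N) t : map i s = t -> \prod_(a <- t) a = 1 -> \prod_(a <- s) a = 1.
  move=> <- s1; apply: i_inj; rewrite gmulf1 -s1 gmulf_prod.
  by rewrite big_map.
apply: P1; suff: P (i 1) by rewrite gmulf1.
apply: (semigroup_dichotomy (S := [set a | P (i a)]) (y := x) (l := l') (m := m') Nn).
- move=> a k k0 /(congr1 i); rewrite gmulf1 gmulfXn => /(tf k0) a1.
  by apply: i_inj; rewrite gmulf1.
- by move=> a b Pa Pb; rewrite /= gmulfM; exact: PM.
- by move=> x1; apply: y1; rewrite -xy x1 gmulf1.
- by rewrite cat_take_drop.
- split=> [|a al]; first by rewrite -size_eq0 -(size_map i) l'l size_eq0; case: lP.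
  have : i a \in l by rewrite -l'l map_f.
  by move=> /lP.2[|/= iay]; [left | right; apply: i_inj; rewrite iay].
- exact: prodE l'l l1.
- split=> [|a al]; first by rewrite -size_eq0 -(size_map i) m'm size_eq0; case: mP.
  have : i a \in m by rewrite -m'm map_f.
  by move=> /mP.2[|/= iay]; [left | right; apply: i_inj; rewrite iay gmulfV xy].
- exact: prodE m'm m1.
Qed.

(** A maximal semigroup that avoids 1 is a positive cone. *)
Theorem semigroup_extends_to_order (S : set G) : semigroup_set S -> ~ S 1 ->
  exists o : left_order G, forall x, S x -> o 1 x.
Proof.
move=> SM /(maximal_semigroup SM)[P [PM SP P1 Pmax]].
have Ptot := maximal_semigroup_total PM P1 Pmax.
pose r : rel G := fun x y => `[< P (x^-1 * y) >].
have r_irr : irreflexive r by move=> x; apply/asboolP; rewrite mulVg.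
have r_trans : transitive r.
  move=> y x z /asboolP xy /asboolP yz; apply/asboolP.
  by rewrite -[z](mulVKg y) mulgA; exact: PM.
have r_total x y : x != y -> r x y || r y x.
  move=> xy; apply/orP; have [|Pxy|Pyx] := Ptot (x^-1 * y).
  - by move=> /mulg1_eq; rewrite invgK => /eqP; rewrite (negPf xy).
  - by left; apply/asboolP.
  - by right; apply/asboolP; rewrite invgM invgK in Pyx.
have r_inv g x y : r x y -> r (g * x) (g * y).
  by rewrite /r invgM -mulgA mulKg.
exists (LeftOrder r_irr r_trans r_total r_inv) => x Sx.
by apply/asboolP; rewrite invg1 mul1g; exact: SP.
Qed.

End ExtendOrder.

(** * Torsion-free locally nilpotent groups *)

Lemma two_letter_word (N : groupType) (a b : N) l : commute a b ->
  (forall c, c \in l -> c = a \/ c = b) ->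
  exists i j, \prod_(c <- l) c = a ^+ i * b ^+ j /\ (i + j = size l)%N.
Proof.
move=> ab; elim: l => [|c l IHl] lab.
  by exists 0%N, 0%N; rewrite big_nil mulg1.
have [|i [j [lij lsz]]] := IHl; first by move=> d dl; apply: lab; rewrite inE dl orbT.
have [->|->] := lab c (mem_head _ _); rewrite big_cons lij /= -lsz.
  by exists i.+1, j; rewrite expgS mulgA.
exists i, j.+1; rewrite addnS expgS !mulgA; split=> //; congr (_ * _).
exact/esym/commute_sym/commuteX/commute_sym.
Qed.

(** Modulo the center [a] and [b] commute, so the word there reads
    [a ^+ i * b ^- j], which is therefore central in the group itself.  Hence
    [a ^+ i] commutes with [b], and so does [a]. *)
Lemma commute_of_positive_word n (N : groupType) (a b : N) :
  nilpotent_le n N -> torsion_free N ->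
  sgen ([set a] `|` [set b^-1]) 1 -> commute a b.
Proof.
elim: n N a b => [|n IHn] N a b Nn Ntf.
  by rewrite (Nn a) // => _; exact/commute_sym/commute1.
move=> [l [l0 lab] l1]; have [Q [p [pS pK Qn Qtf]]] := center_quotient_tf Nn Ntf.
have [/pK bC|/eqP pb1] := eqVneq (p b) 1; first exact/commute_sym/bC.
have pab : commute (p a) (p b).
  apply: IHn => //; exists (map p l); last first.
    by rewrite big_map -gmulf_prod l1 gmulf1.
  split; first by case: (l) l0.
  by move=> _ /mapP[c /lab[->|->] ->]; [left | right; rewrite /= gmulfV].
have [|c|i [j [lij ij]]] := @two_letter_word Q (p a) (p b^-1) (map p l).
- by rewrite gmulfV; exact: commuteV.
- by move=> /mapP[d /lab[->|->] ->]; [left | right].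
move: lij; rewrite big_map -gmulf_prod l1 -!gmulfXn -gmulfM => /esym.
rewrite gmulf1 => /pK; rewrite expVgn => abC.
case: i => [|i] in ij abC *.
  case: pb1; rewrite size_map in ij; have j0 : (0 < j)%N by rewrite -[j]add0n ij; case: (l) l0.
  apply: Qtf j0 _; rewrite -gmulfXn; apply/pK.
  rewrite mul1g in abC; rewrite -[_ ^+ _]invgK.
  exact: (subsetV (central_subgroup N)).
apply: (commute_root Nn Ntf (ltn0Sn i)); rewrite -[a ^+ _](mulgK (b ^- j)).
rewrite invgK; apply: commute_sym; apply: commuteM; last exact: commuteX.
exact/commute_sym/abC.
Qed.

(** Such a commutator generates, with others, the last nontrivial term of the
    lower central series. *)
Lemma central_commutator n (N : groupType) : nilpotent_le n N ->
  ~ abelian_group N -> exists u v : N, [~ u, v] <> 1 /\ central [~ u, v].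
Proof.
elim: n => [|n IHn] Nn nab.
  by case: nab => x y; rewrite (Nn x) // (Nn y).
have [/IHn/(_ nab) //|nNn] := pselect (nilpotent_le n N).
case: n Nn nNn {IHn} => [|n] Nn nNn.
  by case: nab => x y; apply/commgP/eqP/Nn/commutator_in_derived.
apply: contrapT => no; apply: nNn => x.
suff : lower_central n.+1 `<=` [set 1 : N] by exact.
apply: gen_min => [|_ [u nu [v _ <-]]].
  by split=> [|_ _ -> ->|_ ->] /=; rewrite ?mulg1 ?invg1.
apply: contrapT => uv1; apply: no; exists u, v; split=> //.
exact/(nilpotent_le_central Nn)/lower_centralR.
Qed.

Section LocallyNilpotent.
Variable G : groupType.
Hypotheses (tf : torsion_free G) (ln : locally_nilpotent G).

Lemma sub_torsion_free (N : groupType) (i : hom N G) : injective i -> torsion_free N.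
Proof.
move=> i_inj x n n0 /(congr1 i); rewrite gmulfXn gmulf1 => /(tf n0) ix1.
by apply: i_inj; rewrite gmulf1.
Qed.

Lemma hom_commute_inj (N : groupType) (i : hom N G) x y :
  injective i -> commute (i x) (i y) -> commute x y.
Proof. by move=> i_inj ixy; apply: i_inj; rewrite !gmulfM. Qed.

Lemma ln_commute_root (x y : G) n : (0 < n)%N -> commute (x ^+ n) y -> commute x y.
Proof.
move=> n0; have [N [i [m [X [i_inj _ Nm _ Xxy]]]]] := fg_subgroup [:: x; y] ln.
case: X Xxy => [|x' [|y' [|//]]] // [<- <-].
rewrite -gmulfXn => /(hom_commute_inj i_inj) x'y'; apply: gmulf_commute.
exact: commute_root Nm (sub_torsion_free i_inj) n0 x'y'.
Qed.

(** If [x ^+ n = y ^+ n], then [x] commutes with [y] because [x ^+ n] does, and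
    [x * y^-1] is torsion. *)
Lemma ln_expg_inj n : (0 < n)%N -> injective (fun x : G => x ^+ n).
Proof.
move=> n0 x y xy; have cxy : commute x y.
  by apply: (ln_commute_root n0); rewrite xy; exact/commute_sym/commuteX.
apply/divg1_eq/(tf n0); rewrite expgnFl //.
by move: xy => /= ->; rewrite mulgV.
Qed.

Lemma ln_central_commutator (x y : G) : ~ commute x y -> exists u v,
  [/\ gen [set` [:: x; y]] u, gen [set` [:: x; y]] v, [~ u, v] <> 1,
      commute [~ u, v] u /\ commute [~ u, v] v &
      commute [~ u, v] x /\ commute [~ u, v] y].
Proof.
have [N [i [m [X [i_inj iN Nm _ Xxy]]]]] := fg_subgroup [:: x; y] ln.
move=> nxy; have [|u [v [uv1 uvC]]] := central_commutator Nm.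
  move=> Nab; apply: nxy; case: X Xxy => [|x' [|y' [|//]]] // [<- <-].
  exact/gmulf_commute/Nab.
have iC z : commute [~ i u, i v] (i z) by rewrite -gmulfR; exact/gmulf_commute/uvC.
exists (i u), (i v); split=> //; first by rewrite -gmulfR => /eqP; rewrite gmulf_eq1 // => /eqP.
by case: X Xxy => [|x' [|y' [|//]]] // [<- <-].
Qed.

Lemma commensurable_of_positive_word (a b : G) : a <> 1 -> b <> 1 ->
  sgen ([set a] `|` [set b^-1]) 1 ->
  exists i j, [/\ (0 < i)%N, (0 < j)%N & a ^+ i = b ^+ j].
Proof.
move=> a1 b1 [l [l0 lab] l1].
have cab : commute a b.
  have [N [i [m [X [i_inj iN Nm _ Xab]]]]] := fg_subgroup [:: a; b] ln.
  case: X Xab => [|a' [|b' [|//]]] // [ia ib]; rewrite -ia -ib.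
  apply/gmulf_commute/(commute_of_positive_word Nm (sub_torsion_free i_inj)).
  pose lift c := if c == a then a' else b'^-1.
  exists (map lift l).
    split=> [|_ /mapP[c _ ->]]; first by case: (l) l0.
    by rewrite /lift; case: eqP; [left | right].
  apply: i_inj; rewrite gmulf_prod big_map gmulf1 -[RHS]l1.
  apply: eq_big_seq => c /lab cab; rewrite /lift.
  by case: eqP cab => [->|ca [/ca|->]]; rewrite ?gmulfV ?ib ?ia.
have [i [j [lij ij]]] := two_letter_word (commuteV cab) lab.
move: lij; rewrite l1 expVgn => /esym/divg1_eq abij.
have {l0} ij0 : (0 < i + j)%N by rewrite ij; case: (l) l0.
exists i, j; split=> //.
- case: i abij ij0 {ij} => // /esym bj j0; case: b1; exact: tf bj.
- case: j abij ij0 {ij} => //; rewrite addn0 => ai i0; case: a1; exact: tf ai.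
Qed.

End LocallyNilpotent.

(** * Rigidity of embeddings *)

(** Two embeddings of [D] whose values at each [x] have a common positive power.
    The witnesses [n] and [m] depend on [x]; the point is that the ratio is
    always 1. *)
Section Rigidity.
Variables (D G : groupType) (F E : hom D G).
Hypotheses (tf : torsion_free G) (ln : locally_nilpotent G).
Hypotheses (F_inj : injective F) (E_inj : injective E).
Hypothesis FE : forall x, x <> 1 -> exists n m,
  [/\ (0 < n)%N, (0 < m)%N & F x ^+ n = E x ^+ m].

Let Dtf : torsion_free D. Proof. exact: sub_torsion_free F_inj. Qed.

Lemma expg_exponent_inj (x : D) n m : x <> 1 -> x ^+ n = x ^+ m -> n = m.
Proof.
move=> x1; wlog nm : n m / (n <= m)%N => [wl|].
  by case/orP: (leq_total n m) => [/wl //|/wl mn /esym/mn].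
rewrite -[in X in _ = X](subnK nm) expgnDr -[LHS]mul1g => /mulIg/esym xnm.
apply/eqP; rewrite eqn_leq nm -subn_eq0 /= eqn0Ngt; apply/negP => mn0.
by apply/x1/(Dtf mn0).
Qed.

(** The element [w] witnesses the independence of [x] and [z]: a relation would
    express a power of [x] through [z], which commutes with [w]. *)
Lemma independent_exponents (x z w : D) a b c d :
  commute x z -> commute z w -> ~ commute x w -> z <> 1 ->
  x ^+ a * z ^+ b = x ^+ c * z ^+ d -> a = c /\ b = d.
Proof.
move=> xz zw xw z1; wlog ac : a b c d / (a <= c)%N => [wl|].
  by case/orP: (leq_total a c) => [/wl wl' /wl' //|/wl wl' /esym/wl'[-> ->]].
rewrite -[in X in _ = X](subnKC ac) expgnDr -mulgA => /mulgI zxz.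
have ca : a = c.
  apply/eqP; rewrite eqn_leq ac -subn_eq0 eqn0Ngt; apply/negP => ac0; apply: xw.
  apply: (hom_commute_inj F_inj); apply: (ln_commute_root tf ln ac0).
  rewrite -gmulfXn; apply: gmulf_commute.
  rewrite -[x ^+ _](mulgK (z ^+ d)) -zxz -expVgn; apply: commute_sym.
  apply: commuteM; first exact/commuteX/commute_sym.
  by apply/commuteX/commuteV/commute_sym.
split=> //; apply: (expg_exponent_inj z1).
by rewrite zxz ca subnn mul1g.
Qed.

(** Compare the exponents of [x], [z] and [x * z]. *)
Lemma common_ratio (x z w : D) :
  commute x z -> commute z w -> ~ commute x w -> z <> 1 ->
  exists n m, [/\ (0 < n)%N, F x ^+ n = E x ^+ m & F z ^+ n = E z ^+ m].
Proof.
move=> xz zw xw z1; have x1 : x <> 1.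
  by move=> x1; apply: xw; rewrite x1; exact/commute_sym/commute1.
have xz1 : x * z <> 1.
  move=> /mulg1_eq xz1; apply: xw; rewrite -[x]invgK xz1.
  exact/commute_sym/commuteV/commute_sym.
have [n1 [m1 [n10 _ e1]]] := FE x1; have [n2 [m2 [n20 _ e2]]] := FE z1.
have [n3 [m3 [n30 _ e3]]] := FE xz1; pose n := (n1 * n2 * n3)%N.
have ex : F x ^+ n = E x ^+ (m1 * (n2 * n3)).
  by rewrite /n -mulnA expgnA e1 -expgnA.
have ez : F z ^+ n = E z ^+ (m2 * (n1 * n3)).
  by rewrite /n -mulnA mulnCA expgnA e2 -expgnA.
have exz : F (x * z) ^+ n = E (x * z) ^+ (m3 * (n1 * n2)).
  by rewrite /n mulnC expgnA e3 -expgnA.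
move: exz; rewrite !gmulfM !expgMn; [|exact: gmulf_commute..].
rewrite ex ez -!gmulfXn -!gmulfM => /E_inj/(independent_exponents xz zw xw z1)[m13 m23].
rewrite m23 -m13 in ez.
by exists n, (m1 * (n2 * n3))%N; rewrite !muln_gt0 n10 n20 n30.
Qed.

Lemma ratio_transfer (x z : D) k l n m : x <> 1 -> (0 < k)%N ->
  F x ^+ k = E x ^+ l -> F z ^+ k = E z ^+ l ->
  F x ^+ n = E x ^+ m -> F z ^+ n = E z ^+ m.
Proof.
move=> x1 k0 xkl zkl xnm.
have e : (m * k = l * n)%N.
  apply: (expg_exponent_inj x1); apply: E_inj.
  by rewrite !gmulfXn !expgnA -xnm -xkl expgnAC.
apply: (ln_expg_inj tf ln k0) => /=.
by rewrite expgnAC zkl -!expgnA e.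
Qed.

(** Take a nontrivial commutator [z = [~ u, v]] that commutes with [u], [v], [x]
    and [w].  With [m / n] the common ratio of [u], [v] and [z], computing
    [F z ^+ (n * n)] as a commutator and as a power gives
    [m * m = m * n].  So [F] and [E] agree on [z], hence on [x], which is
    independent of [z]. *)
Lemma agree_on_noncentral (x w : D) : ~ commute x w -> F x = E x.
Proof.
move=> xw; have Fxw : ~ commute (F x) (F w) by move/(hom_commute_inj F_inj).
have im : gen [set` [:: F x; F w]] `<=` range F.
  apply: gen_min => [|y /=]; last first.
    by rewrite !inE => /orP[] /eqP->; [exists x | exists w].
  split=> [|_ _ [a _ <-] [b _ <-]|_ [a _ <-]].
  - by exists 1; rewrite ?gmulf1.
  - by exists (a * b); rewrite ?gmulfM.
  - by exists a^-1; rewrite ?gmulfV.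
have [_ [_ [/im[u _ <-] /im[v _ <-]]]] := ln_central_commutator ln Fxw.
rewrite -gmulfR; set z := [~ u, v].
move=> Fz1 [/(hom_commute_inj F_inj) zu /(hom_commute_inj F_inj) zv].
move=> [/(hom_commute_inj F_inj) zx /(hom_commute_inj F_inj) zw].
have z1 : z <> 1 by move=> z1; apply: Fz1; rewrite z1 gmulf1.
have uv : ~ commute u v by move/commgP/eqP.
have u1 : u <> 1 by move=> u1; apply: z1; rewrite /z u1 comm1g.
have [n [m [n0 m0 unm]]] := FE u1.
have [k [l [k0 ukl zkl]]] := common_ratio (commute_sym zu) zv uv z1.
have znm := ratio_transfer u1 k0 ukl zkl unm.
have vu : ~ commute v u by move/commute_sym.
have [k' [l' [k'0 vkl' zkl']]] := common_ratio (commute_sym zv) zu vu z1.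
have vnm := ratio_transfer z1 k'0 zkl' vkl' znm.
have mn : m = n.
  have : E z ^+ (m * n) = E z ^+ (m * m).
    rewrite expgnA -znm -expgnA -!gmulfXn /z -!(commXgX _ _ zu zv).
    by rewrite !gmulfR !gmulfXn unm vnm.
  rewrite -!gmulfXn => /E_inj/(expg_exponent_inj z1)/eqP.
  by rewrite eqn_pmul2l // => /eqP.
have Fz : F z ^+ 1 = E z ^+ 1.
  by apply: (ln_expg_inj tf ln n0) => /=; rewrite !expg1 znm mn.
have [i [j [i0 xij zij]]] := common_ratio (commute_sym zx) zw xw z1.
exact: (ratio_transfer z1 i0 zij xij Fz).
Qed.

Theorem homs_with_commensurable_values_agree : ~ abelian_group D -> F =1 E.
Proof.
move=> nab x; have [[w /agree_on_noncentral //]|xC] := pselect (exists w, ~ commute x w).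
have {}xC w : commute x w by apply: contrapT => xw; apply: xC; exists w.
have [->|/eqP x1] := eqVneq x 1; first by rewrite !gmulf1.
have [u [v uv]] : exists u v : D, ~ commute u v.
  apply: contrapT => no; apply: nab => u v; apply: contrapT => uv.
  by apply: no; exists u, v.
have u1 : u <> 1 by move=> u1; apply: uv; rewrite u1; exact/commute_sym/commute1.
have [k [l [k0 ukl xkl]]] := common_ratio (commute_sym (xC u)) (xC v) uv x1.
exact: (ratio_transfer (n := 1) (m := 1) u1 k0 ukl xkl (agree_on_noncentral uv)).
Qed.

End Rigidity.

(** * The action of commensurations on left orders *)

Section Action.
Variable G : groupType.
Hypotheses (tf : torsion_free G) (ln : locally_nilpotent G).

Lemma lo_asym (K : groupType) (o : left_order K) x y : o x y -> o y x = false.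
Proof.
move=> xy; apply/negP => yx; have := lo_trans xy yx.
by rewrite lo_irr.
Qed.

Lemma lo_lt1 (K : groupType) (o : left_order K) x y : o x y = o 1 (x^-1 * y).
Proof.
apply/idP/idP => [/(lo_inv x^-1)|/(lo_inv x)]; first by rewrite mulVg.
by rewrite mulg1 mulVKg.
Qed.

Lemma lo_restrE (H : groupClosed G) (o : left_order G) x y :
  lo_restr H o x y = o (val x) (val y).
Proof. by []. Qed.

(** The positive elements of the subgroup form a semigroup that avoids 1; an
    order whose cone contains it restricts to the given one by totality. *)
Lemma lo_restr_surj (H : groupClosed G) (q : left_order (subg_of H)) :
  exists o : left_order G, lo_restr H o = q.
Proof.
pose S : set G := [set val a | a in [set a | q 1 a]].
have [|[a /= qa a1]|o So] := semigroup_extends_to_order tf ln (S := S).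
- move=> _ _ [a /= qa <-] [b /= qb <-]; exists (a * b); last exact: valM.
  by apply: lo_trans qa _; move: qb => /(lo_inv a); rewrite mulg1.
- have a1' : a = 1 by apply: val_inj; rewrite val1; exact: a1.
  by rewrite a1' lo_irr in qa.
have qo x y : q x y -> o (val x) (val y).
  rewrite lo_lt1 => qxy; rewrite lo_lt1; apply: So.
  by exists (x^-1 * y); rewrite // valM (gmulfV val).
exists o; apply: left_order_ext => x y /=.
have [->|/(lo_total q)/orP[xy|yx]] := eqVneq x y; first by rewrite !lo_irr.
  by rewrite xy qo.
by rewrite (lo_asym yx) (lo_asym (qo _ _ yx)).
Qed.

Lemma comm_act_maps (o : left_order G) (f : commensuration G) x y :
  maps f x y -> comm_act o f 1 y = o 1 x.
Proof.
move=> [a [<- <-]].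
have /(xgetPex o) /= ext := lo_restr_surj (lo_image (comm_iso f) (lo_restr (dom f) o)).
have := congr1 (fun q : left_order _ => q 1 (f a)) ext.
have f1 : f 1 = 1.
  by apply: (@mulgI _ (f 1)); rewrite -isoM !mulg1.
by rewrite -{2}f1 lo_imageE !lo_restrE !val1.
Qed.

(** If no relation held, some order [o] would make [a] and [b^-1] positive.
    Pulling [o] back along [f] gives an order [o'] in which [x] is positive; its
    images under [f] and [g] coincide, and make [b] positive as the value of [g]
    at [x].  As [b] is in the codomain of [f], that image has the same sign at
    [b] as [o]. *)
Lemma same_action_commensurable (f g : commensuration G) x a b :
    (forall o, comm_act o f = comm_act o g) ->
    maps f x a -> maps g x b -> b \in cod f -> a <> 1 -> b <> 1 ->
  exists i j, [/\ (0 < i)%N, (0 < j)%N & a ^+ i = b ^+ j].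
Proof.
move=> fg fxa gxb bf a1 b1; apply: commensurable_of_positive_word => //.
apply: contrapT => no.
have [o oS] := semigroup_extends_to_order tf ln (@sgen_semigroup _ _) no.
have oa : o 1 a by apply/oS/sub_sgen; left.
have ob : o 1 b^-1 by apply/oS/sub_sgen; right.
have [y /maps_inv fyb] := (maps_dom (comm_inv f) b).1 bf.
pose o' := comm_act o (comm_inv f).
have o'f t c : maps f t c -> o' 1 t = o 1 c.
  by move=> ftc; apply: comm_act_maps; apply/maps_inv.
have : o 1 b.
  rewrite -(o'f _ _ fyb) -(comm_act_maps _ fyb) fg (comm_act_maps _ gxb).
  by rewrite (o'f _ _ fxa).
move=> /(lo_inv b^-1); rewrite mulg1 mulVg => b'1.
by have := lo_trans ob b'1; rewrite lo_irr.
Qed.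

Lemma maps_hom (f : commensuration G) (H : groupClosed G) :
  {subset H <= dom f} ->
  exists F : hom (subg_of H) G, forall x, maps f (val x) (F x).
Proof.
move=> Hf; have ex (x : subg_of H) : exists y, maps f (val x) y.
  by apply/maps_dom/Hf/subg_valP.
have [F fF] := choice ex.
have FM : monoid_morphism F.
  split; first by apply: maps_fun (fF _) _; rewrite val1; exact: maps1.
  by move=> x y; apply: maps_fun (fF _) _; rewrite valM; exact: mapsM.
by exists (HB.pack_for (hom (subg_of H) G) F (isUMagmaMorphism.Build _ _ F FM)).
Qed.

Lemma maps_inj (f : commensuration G) x x' y : maps f x y -> maps f x' y -> x = x'.
Proof. by move=> /maps_inv fx /maps_inv; exact: maps_fun fx. Qed.

Lemma finite_index_root (H : groupClosed G) x :
  finite_index (fullg G) H -> exists2 n, (0 < n)%N & x ^+ n \in H.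
Proof.
move=> [_ fH]; apply: contrapT => no; apply: infinite_nat.
pose c n := left_coset H (x ^+ n).
have c_inj : injective c.
  move=> n m; wlog nm : n m / (n <= m)%N => [wl|].
    by case/orP: (leq_total n m) => [/wl //|/wl mn /esym/mn].
  move=> /left_cosetP; rewrite -[in X in X -> _](subnKC nm) expgnDr mulKg => xnm.
  apply/eqP; rewrite eqn_leq nm -subn_eq0 eqn0Ngt; apply/negP => mn0.
  by apply: no; exists (m - n)%N.
rewrite -(eq_finite_set (inj_card_eq (in2W c_inj))); apply: sub_finite_set fH.
by move=> _ [n _ <-]; exists (x ^+ n).
Qed.

Lemma finite_index_nonabelian (H : groupClosed G) :
  finite_index (fullg G) H -> ~ abelian_group G -> ~ abelian_group (subg_of H).
Proof.
move=> iH nab Hab; apply: nab => x y.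
have [n n0 xH] := finite_index_root x iH; have [m m0 yH] := finite_index_root y iH.
apply: (ln_commute_root tf ln n0); apply: commute_sym.
apply: (ln_commute_root tf ln m0); apply: commute_sym.
by have := congr1 val (Hab (Subg xH) (Subg yH)); rewrite !valM.
Qed.

End Action.

Theorem proposition1p6 (G : groupType)
  (nonabelian : ~ abelian_group G)
  (tf : torsion_free G)
  (ln : locally_nilpotent G) :
  forall c d : Comm G,
    (forall o : left_order G, Comm_act o c = Comm_act o d) -> c = d.
Proof.
move=> c d cd; rewrite -[c]reprK -[d]reprK; apply/comm_classP/comm_equivP.
set f := repr c; set g := repr d.
pose H : groupClosed G := capg (dom f) (preg g (cod f)).
have iH : finite_index (fullg G) H.
  by apply: finite_index_cap; [exact: dom_index | exact/preg_index/cod_index].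
have Hf : {subset H <= dom f} by move=> x /andP[].
have Hg : {subset H <= dom g}.
  by move=> x /andP[_ /pregP[y [gxy _]]]; apply/maps_dom; exists y.
have [F fF] := maps_hom Hf; have [E gE] := maps_hom Hg.
have F_inj : injective F.
  by move=> x y Fxy; apply/val_inj/(maps_inj (fF x)); rewrite Fxy.
have E_inj : injective E.
  by move=> x y Exy; apply/val_inj/(maps_inj (gE x)); rewrite Exy.
have FE : F =1 E.
  apply: (homs_with_commensurable_values_agree tf ln F_inj E_inj).
    move=> x x1; apply: (same_action_commensurable tf ln _ (fF x) (gE x)).
    - exact: cd.
    - have /andP[_ /pregP[y [gxy yf]]] := subg_valP x.
      by rewrite (maps_fun (gE x) gxy).
    - by move=> /eqP; rewrite gmulf_eq1 // => /eqP.
    - by move=> /eqP; rewrite gmulf_eq1 // => /eqP.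
  exact: finite_index_nonabelian.
exists H; split=> // x xH; exists (F (Subg xH)); split; first exact: (fF (Subg xH)).
by rewrite FE; exact: (gE (Subg xH)).
Qed.
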